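(* Let $C$ be a triangulation of a $3$-manifold, and suppose that for some $k$ and some nonzero vector $\pi\in\mathbb{R}^k$ the complex $C$ has a $\pi$-tight linear embedding in $\mathbb{R}^k$ with respect to which $\pi$ is in general position (no two vertices of the embedded complex have the same value of the linear functional $\langle\pi,-\rangle$). Then $C$ admits a perfect discrete Morse function.
   Context: Simplicial complexes are finite; manifolds may have boundary. Homology is taken with $\mathbb{Z}_2$-coefficients, and $\beta_i$ denotes the $i$-th non-reduced Betti number. Let $|C|\subset\mathbb{R}^k$ be a linear embedding (geometric realization) of a simplicial complex $C$, and let $\pi\in\mathbb{R}^k$ be a nonzero vector. For an affine hyperplane $h$ orthogonal to $\pi$, let $h^+$ be the open halfspace delimited by $h$ in direction $\pi$. $|C|$ is $\pi$-tight if for every affine hyperplane $h$ orthogonal to $\pi$ and every $i$ the homomorphism $H_i(h^+\cap|C|)\to H_i(|C|)$ induced by inclusion is injective. A discrete Morse function on $C$ is a weakly increasing map $f$ from the poset of nonempty faces of $C$ (ordered by inclusion) to $\mathbb{Z}$ that is at most $2$-to-$1$. A face $\sigma$ is critical under $f$ if $f$ is strictly increasing at $\sigma$, i.e. there is no face $\tau\neq\sigma$ comparable to $\sigma$ with $f(\tau)=f(\sigma)$. The function is perfect if for each $i$ it has exactly $\beta_i(C)$ critical $i$-dimensional faces. *)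

(* Defs.v *)
From HB Require Import structures.
From mathcomp Require Import all_boot all_order all_algebra.
From mathcomp Require Import all_classical all_reals all_analysis.
From mathcomp Require Import freeg.

Set Implicit Arguments.
Unset Strict Implicit.
Unset Printing Implicit Defensive.

Import Order.TTheory GRing.Theory Num.Theory.
Import numFieldNormedType.Exports.

Local Open Scope ring_scope.

(* A complex is given by its set of nonempty faces; a point of [V] is a vertex
   of [C] only if its singleton is a face. *)
Definition simplicial_complex (V : finType) (C : {set {set V}}) : Prop :=
  finset.set0 \notin C /\
  forall s t : {set V}, s \in C -> t != finset.set0 -> t \subset s -> t \in C.

(* The faces with [n] vertices, i.e. of dimension [n - 1]. *)
Definition faces (V : finType) (C : {set {set V}}) (n : nat) : {set {set V}} :=
  [set s in C | #|s| == n].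

(* Matrix over Z/2, acting on row vectors, of the simplicial boundary from
   faces with [n] vertices to faces with [n - 1] vertices. As set0 is not a
   face, it has no columns when [n = 1]: the homology is not reduced. *)
Definition boundary_mx (V : finType) (C : {set {set V}}) (n : nat) :
    'M['F_2]_(#|faces C n|, #|faces C n.-1|) :=
  \matrix_(a < #|faces C n|, b < #|faces C n.-1|)
    (enum_val b \subset enum_val a)%:R.

(* dim Z_i - dim B_i *)
Definition betti (V : finType) (C : {set {set V}}) (i : nat) : nat :=
  (\rank (kermx (boundary_mx C i.+1)) - \rank (boundary_mx C i.+2))%N.

Definition discrete_morse (V : finType) (C : {set {set V}})
    (f : {set V} -> int) : Prop :=
  (forall s t : {set V}, s \in C -> t \in C -> s \subset t -> f s <= f t) /\
  (forall z : int, (#|[set s in C | f s == z]| <= 2)%N).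

Definition critical (V : finType) (C : {set {set V}}) (f : {set V} -> int)
    (s : {set V}) : bool :=
  [forall t in C, (t != s) && ((t \subset s) || (s \subset t)) ==>
                  (f t != f s)].

Definition perfect (V : finType) (C : {set {set V}})
    (f : {set V} -> int) : Prop :=
  forall i : nat, #|[set s in faces C i.+1 | critical C f s]| = betti C i.

Local Open Scope classical_set_scope.

(* Barycentric coordinates of the points of [C]: convex weights on the vertices,
   supported on a face. *)
Definition barycentric (R : realType) (V : finType) (C : {set {set V}}) :
    set {ffun V -> R} :=
  [set w | (forall v, 0 <= w v) /\ \sum_v w v = 1 /\
           exists2 s : {set V}, s \in C & forall v, v \notin s -> w v = 0].

Arguments barycentric R {V} C.

Definition affine_ext (R : realType) (V : finType) (k : nat)
    (p : V -> 'rV[R]_k) (w : {ffun V -> R}) : 'rV[R]_k :=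
  \sum_v w v *: p v.

Definition polyhedron (R : realType) (V : finType) (C : {set {set V}})
    (k : nat) (p : V -> 'rV[R]_k) : set 'rV[R]_k :=
  affine_ext p @` barycentric R C.

(* The map sending each vertex [v] to [p v] and affine on faces is injective,
   hence a topological embedding since [C] is finite. *)
Definition linear_embedding (R : realType) (V : finType) (C : {set {set V}})
    (k : nat) (p : V -> 'rV[R]_k) : Prop :=
  {in barycentric R C &, injective (affine_ext p)}.

(* The realization of [C] inside the standard simplex on [V]. *)
Definition standard_polyhedron (R : realType) (V : finType)
    (C : {set {set V}}) : set 'rV[R]_#|V| :=
  polyhedron C (fun v => delta_mx 0 (enum_rank v)).

Arguments standard_polyhedron R {V} C.

Definition homeomorphic (S T : topologicalType) (A : set S) (B : set T) : Prop :=
  exists (f : S -> T) (g : T -> S),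
    {within A, continuous f} /\ {within B, continuous g} /\
    (forall x, A x -> B (f x) /\ g (f x) = x) /\
    (forall y, B y -> A (g y) /\ f (g y) = y).

(* {x in R^n | 0 <= x_0}; all of R^0 when [n = 0] *)
Definition closed_half (R : realType) (n : nat) : set 'rV[R]_n :=
  [set x | forall i : 'I_n, i = 0%N :> nat -> 0 <= x 0 i].

Arguments closed_half R n : clear implicits.

(* Every point of [X] has a relatively open neighbourhood homeomorphic to an
   open subset of the closed half-space. Being a subset of a Euclidean space,
   [X] is Hausdorff and second countable. *)
Definition manifold_with_boundary (R : realType) (n m : nat)
    (X : set 'rV[R]_m) : Prop :=
  forall x, X x ->
    exists (U : set 'rV[R]_m) (W : set 'rV[R]_n),
      [/\ open U, U x, open W &
          homeomorphic (X `&` U) (closed_half R n `&` W)].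

Definition triangulates_manifold (R : realType) (n : nat) (V : finType)
    (C : {set {set V}}) : Prop :=
  manifold_with_boundary n (standard_polyhedron R C).

Definition std_simplex (R : realType) (n : nat) : set 'rV[R]_n.+1 :=
  [set t | (forall i, 0 <= t 0 i) /\ \sum_i t 0 i = 1].

Arguments std_simplex R n : clear implicits.

Definition face_vec (R : realType) (n : nat) (i : 'I_n.+2)
    (t : 'rV[R]_n.+1) : 'rV[R]_n.+2 :=
  \row_j oapp (t 0) 0 (unlift i j).

Lemma face_vec_subproof (R : realType) (n : nat) (i : 'I_n.+2)
    (t : std_simplex R n) : face_vec i (set_val t) \in std_simplex R n.+1.
Proof.
have [t0 t1] := set_mem (valP t); apply/mem_set; split=> [j|].
  by rewrite mxE; case: unliftP => [k|] _ //=.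
rewrite (bigD1_ord i) //= mxE unlift_none add0r -[RHS]t1.
by apply: eq_bigr => j _; rewrite mxE liftK.
Qed.

Definition coface (R : realType) (n : nat) (i : 'I_n.+2)
    (t : std_simplex R n) : std_simplex R n.+1 :=
  SigSub (face_vec_subproof i t).

(* Free Z/2-module on all maps from the standard n-simplex to [T]; continuity
   is required in [singular_chain]. *)
Notation chain R n T := {freeg (set_type (std_simplex R n) -> T) / 'F_2}.

Definition boundary (R : realType) (n : nat) (T : topologicalType)
    (c : chain R n.+1 T) : chain R n T :=
  fglift (fun s : set_type (std_simplex R n.+1) -> T =>
            \sum_(i < n.+2) << s \o coface i >>) c.

Definition singular_chain (R : realType) (n : nat) (T : topologicalType)
    (X : set T) (c : chain R n T) : Prop :=
  forall s, s \in dom c -> continuous s /\ (forall t, X (s t)).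

Definition closed_chain (R : realType) (T : topologicalType) (n : nat) :
    chain R n T -> Prop :=
  if n is n'.+1 then fun c => boundary c = 0 else fun=> True.

Definition singular_cycle (R : realType) (n : nat) (T : topologicalType)
    (X : set T) (c : chain R n T) : Prop :=
  singular_chain X c /\ closed_chain c.

Definition homologous (R : realType) (n : nat) (T : topologicalType)
    (X : set T) (c c' : chain R n T) : Prop :=
  exists2 b : chain R n.+1 T, singular_chain X b & c - c' = boundary b.

(* For [A] contained in [X], the map H_n(A) -> H_n(X) induced by inclusion is
   injective. Singular chains of [A] are literally singular chains of [X]. *)
Definition homology_injective (R : realType) (n : nat) (T : topologicalType)
    (A X : set T) : Prop :=
  forall c c' : chain R n T, singular_cycle A c -> singular_cycle A c' ->
    homologous X c c' -> homologous A c c'.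

Arguments homology_injective R n {T} A X.

Definition dotp (R : realType) (k : nat) (x y : 'rV[R]_k) : R :=
  \sum_i x 0 i * y 0 i.

(* h^+ for the hyperplane h = {x | <dir, x> = a} *)
Definition open_half (R : realType) (k : nat) (dir : 'rV[R]_k) (a : R) :
    set 'rV[R]_k :=
  [set x | a < dotp dir x].

Definition tight (R : realType) (k : nat) (dir : 'rV[R]_k)
    (X : set 'rV[R]_k) : Prop :=
  forall (a : R) (i : nat),
    homology_injective R i (open_half dir a `&` X) X.

Definition general_position (R : realType) (V : finType) (C : {set {set V}})
    (k : nat) (p : V -> 'rV[R]_k) (dir : 'rV[R]_k) : Prop :=
  forall u v : V, [set u]%SET \in C -> [set v]%SET \in C -> u != v ->
    dotp dir (p u) != dotp dir (p v).

(* Main.v *)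
(* Order the vertices by decreasing height <dir, ->.  Adding a vertex v to the
   full subcomplex on the higher vertices adds the cone with apex v over a
   subcomplex L of the link of v.  As |C| is a 3-manifold, L has dimension at
   most 2 and every edge of L lies in at most two triangles of L; hence L, with
   the empty face included, can be dismantled by removing free pairs, or a top
   face lying on a cycle.  A critical face s of L on a cycle z gives a critical
   face of C that lies on a cycle too: by tightness z, which bounds the cone
   over z, also bounds a chain among the higher vertices.  So the critical faces
   of C each create a homology class, and they are as many as the Betti numbers.

   Tightness speaks of singular homology.  To recover the simplicial statement,
   subdivide a singular chain finely, label each point by a highest-weight vertex
   above the hyperplane, and send each small simplex to the face spanned by its
   labels; by Sperner's lemma this fixes simplicial chains.

   If C had a face with five vertices, or a triangle in three tetrahedra, a
   neighbourhood of a point of |C| would contain a family h(q), q in R^4, with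
   h(q) <> h(-q) for q <> 0, and a chart f would turn it into the odd map
   f(h(q)) - f(h(-q)), contradicting the Borsuk-Ulam theorem in dimension 3. *)
Require Import Defs.
From mathcomp Require Import all_boot all_order all_algebra.
From mathcomp Require Import all_classical all_reals all_analysis.
From mathcomp Require Import freeg ring lra zify.
From mathcomp Require Import fintype finset.

Set Implicit Arguments.
Unset Strict Implicit.
Unset Printing Implicit Defensive.

Import Order.TTheory GRing.Theory Num.Theory.
Import numFieldNormedType.Exports.

Local Open Scope ring_scope.

(** Pairing faces is not enough: the critical ones must also be counted. The invariant carried along
    is that each critical face is the last face, in the order of the Morse function, of some cycle.
    The boundary of the upper face of a pair is likewise a cycle, ending at the lower face. Hence
    the rows of the upper faces form a basis of the row space of each boundary matrix, and the count
    becomes a matter of ranks.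

    The complex is taken apart from its lowest vertex upwards. The subcomplexes met on the way
    contain, with each vertex, all faces of [C] above it, and therefore the filling chains that
    tightness supplies.

    A single combinatorial subdivision, acting on lists that may repeat entries, serves both
    topological inputs: the identity that it commutes with the coboundary yields the Borsuk-Ulam
    theorem, Sperner's lemma and the chain map from singular to simplicial chains. A chart enters
    only as a continuous injection into R^3, so interior and boundary points of the manifold are
    treated alike. *)

Lemma addF2 (x : 'F_2) : x + x = 0.
Proof. by apply: addrr_pchar2; rewrite pchar_Fp. Qed.

Lemma F2_neq0 (x : 'F_2) : x != 0 -> x = 1.
Proof. by case: x => [[|[|//]] i] // _; apply/val_inj. Qed.

Lemma F2_bool (b : bool) : (b%:R : 'F_2) != 0 -> b.
Proof. by case: b; rewrite ?eqxx. Qed.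

(** * Ordered simplices and barycentric subdivision *)

Section Facets.
Variable E : eqType.
Implicit Types (s t m : seq E) (F G : seq E -> 'F_2).

(** Lists are ordered simplices, possibly degenerate; the empty list is a simplex too, so the
    cochain complex is augmented. *)
Fixpoint facets s : seq (seq E) :=
  if s is x :: s' then s' :: [seq x :: t | t <- facets s'] else [::].

Definition cobd F s : 'F_2 := \sum_(t <- facets s) F t.

Lemma cobd_cons F x s :
  cobd F (x :: s) = F s + cobd (fun t => F (x :: t)) s.
Proof. by rewrite /cobd /= big_cons big_map. Qed.

Lemma cobd_cobd F s : cobd (cobd F) s = 0.
Proof.
elim: s F => [|x s IH] F; first by rewrite /cobd big_nil.
rewrite cobd_cons; under [X in _ + X]eq_bigr do rewrite cobd_cons.
by rewrite big_split /= -!/(cobd _ s) IH addr0 addF2.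
Qed.

Lemma facets_subseq s t : t \in facets s -> subseq t s.
Proof.
elim: s t => //= x s IH t; rewrite inE => /orP[/eqP->|/mapP[u us ->]].
  exact: subseq_cons.
by rewrite /= eqxx IH.
Qed.

Lemma size_facets s t : t \in facets s -> size s = (size t).+1.
Proof.
elim: s t => //= x s IH t; rewrite inE => /orP[/eqP->//|/mapP[u us ->]] /=.
by rewrite (IH u).
Qed.

Lemma mem_facets s t x : t \in facets s -> x \in t -> x \in s.
Proof. by move=> /facets_subseq /mem_subseq; apply. Qed.

End Facets.

Lemma facets_map (E E' : eqType) (f : E -> E') (s : seq E) :
  facets (map f s) = map (map f) (facets s).
Proof.
elim: s => //= x s ->; congr (_ :: _).
by rewrite -!map_comp; apply: eq_map.
Qed.

Lemma cobd_map (E E' : eqType) (f : E -> E') (F : seq E' -> 'F_2) (s : seq E) :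
  cobd F (map f s) = cobd (fun t => F (map f t)) s.
Proof. by rewrite /cobd facets_map big_map. Qed.

(* [b] chooses the apex over which the subdivision of the boundary is coned *)
Section Subdivision.
Variables (E : eqType) (b : seq E -> E).
Implicit Types (s t m : seq E) (F : seq E -> 'F_2).

(** [n] is fuel, meant to be [size s]. Each result lists the apices of a full flag of faces, from
    [s] down to a vertex. *)
Fixpoint sd_rec n s : seq (seq E) :=
  if n is n'.+1 then [seq b s :: m | t <- facets s, m <- sd_rec n' t]
  else [:: [::]].

Definition sd s := sd_rec (size s) s.

Lemma sd_cons x s :
  sd (x :: s) = [seq b (x :: s) :: m | t <- facets (x :: s), m <- sd_rec (size s) t].
Proof. by []. Qed.

Lemma big_sd F x s : \sum_(m <- sd (x :: s)) F m =
  \sum_(t <- facets (x :: s)) \sum_(m <- sd t) F (b (x :: s) :: m).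
Proof.
rewrite sd_cons big_allpairs_dep.
by apply: eq_big_seq => t /size_facets[->].
Qed.

Lemma sd_consP x s m : m \in sd (x :: s) ->
  exists t m', [/\ t \in facets (x :: s), m' \in sd t & m = b (x :: s) :: m'].
Proof.
rewrite sd_cons.
case/allpairsPdep => t [m' [ts mm' ->]]; exists t, m'; split=> //.
by have [e] := size_facets ts; rewrite /sd -e.
Qed.

(** Subdivision is a chain map: the cone b * sd(ds) has boundary sd(ds) + b * d(sd(ds)), and by
    induction d(sd(ds)) = sd(dds) = 0. *)
Lemma cobd_sd F s :
  \sum_(m <- sd s) cobd F m = cobd (fun t => \sum_(m <- sd t) F m) s.
Proof.
have [n] := ubnP (size s); elim: n s F => // n IH [|x s] F.
  by move=> _; rewrite /sd /= big_seq1 /cobd !big_nil.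
rewrite ltnS => le_sn; rewrite big_sd.
under eq_bigr do under eq_bigr do rewrite cobd_cons.
under eq_bigr do rewrite big_split /=.
rewrite big_split /= -/(cobd _ (x :: s)).
rewrite [X in _ + X](_ : _ =
  cobd (cobd (fun t => \sum_(m <- sd t) F (b (x :: s) :: m))) (x :: s)).
  by rewrite cobd_cobd addr0.
by apply: eq_big_seq => t /(@size_facets _ (x :: s)) e; rewrite IH // -ltnS -e.
Qed.

Fixpoint sds N s : seq (seq E) :=
  if N is N'.+1 then flatten [seq sds N' m | m <- sd s] else [:: s].

Lemma big_sds F N s : \sum_(m <- sds N.+1 s) F m =
  \sum_(m <- sd s) \sum_(m' <- sds N m) F m'.
Proof. by rewrite [sds _ _]/= big_flatten big_map. Qed.

Lemma sdsS N s m : m \in sds N.+1 s -> exists2 t, t \in sd s & m \in sds N t.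
Proof. by case/flatten_mapP => t; exists t. Qed.

Lemma cobd_sds F N s :
  \sum_(m <- sds N s) cobd F m = cobd (fun t => \sum_(m <- sds N t) F m) s.
Proof.
elim: N s F => [|N IH] s F.
  by rewrite big_seq1; apply: eq_bigr => t _; rewrite big_seq1.
rewrite big_sds; under eq_bigr do rewrite IH; rewrite cobd_sd.
by apply: eq_bigr => t _; rewrite big_sds.
Qed.

Lemma size_sd s m : m \in sd s -> size m = size s.
Proof.
have [n] := ubnP (size s); elim: n s m => // n IH [|x s] m le_sn.
  by rewrite inE => /eqP->.
case/sd_consP => t [m' [ts m't ->]]; have st := size_facets ts.
by rewrite st /= (IH _ _ _ m't) //; rewrite st in le_sn.
Qed.

Lemma size_sds N s m : m \in sds N s -> size m = size s.
Proof.
elim: N s => [|N IH] s; first by rewrite inE => /eqP->.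
by case/sdsS => t /size_sd <- /IH.
Qed.

(** Stands in for convexity of [P]: the points of a subdivision inherit [P] from the corners of the
    simplex. *)
Definition apex_closed (P : E -> Prop) :=
  forall s, s != [::] -> (forall x, x \in s -> P x) -> P (b s).

Lemma sd_closed P s m : apex_closed P -> (forall x, x \in s -> P x) ->
  m \in sd s -> forall x, x \in m -> P x.
Proof.
move=> bP; have [n] := ubnP (size s); elim: n s m => // n IH [|y s] m le_sn sP.
  by rewrite inE => /eqP-> x.
case/sd_consP => t [m' [ts m't ->]] x; rewrite inE => /orP[/eqP->|xm'].
  exact: bP.
apply: (IH t m') xm' => // [|z zt]; first by rewrite (size_facets ts) in le_sn.
by apply: sP; apply: mem_facets zt.
Qed.

Lemma sds_closed P N s m : apex_closed P -> (forall x, x \in s -> P x) ->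
  m \in sds N s -> forall x, x \in m -> P x.
Proof.
move=> bP; elim: N s => [|N IH] s sP; first by rewrite inE => /eqP->.
by case/sdsS => t /(sd_closed bP sP) tP /IH; apply.
Qed.

End Subdivision.

Section SubdivisionMap.
Variables (E E' : eqType) (b : seq E -> E) (b' : seq E' -> E') (f : E -> E').
Hypothesis bf : forall s, b' (map f s) = f (b s).

Lemma sd_map s : sd b' (map f s) = map (map f) (sd b s).
Proof.
rewrite /sd size_map; move: (size s) => n; elim: n s => //= n IH s.
rewrite bf facets_map /allpairs_dep -!map_comp map_flatten -map_comp.
congr flatten; apply: eq_map => t /=; rewrite IH -!map_comp.
exact: eq_map.
Qed.

Lemma sds_map N s : sds b' N (map f s) = map (map f) (sds b N s).
Proof.
elim: N s => //= N IH s; rewrite sd_map map_flatten -!map_comp.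
by congr flatten; apply: eq_map => t /=; rewrite IH.
Qed.

End SubdivisionMap.

(** * Barycentres and the mesh of iterated subdivisions *)

Section Barycentre.
Variables (R : realType).

Definition bary (n : nat) (s : seq 'rV[R]_n) : 'rV[R]_n :=
  (size s)%:R^-1 *: \sum_(x <- s) x.

Lemma bary_mul (m n : nat) (A : 'M[R]_(m, n)) s :
  bary (map (mulmxr A) s) = mulmxr A (bary s).
Proof.
rewrite /bary size_map big_map /= -scalemxAl; congr (_ *: _).
by rewrite mulmx_suml.
Qed.

Lemma bary_opp (n : nat) (s : seq 'rV[R]_n) : bary (map -%R s) = - bary s.
Proof. by rewrite /bary size_map big_map sumrN scalerN. Qed.

Lemma size_unit (T : eqType) (s : seq T) : s != [::] -> (size s)%:R != 0 :> R.
Proof. by rewrite pnatr_eq0 size_eq0. Qed.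

Lemma mean_const (n : nat) (T : eqType) (s : seq T) (c : 'rV[R]_n) :
  s != [::] -> (size s)%:R^-1 *: \sum_(x <- s) c = c.
Proof.
move=> /size_unit k0; rewrite big_const_seq count_predT iter_addr_0.
by rewrite -[c *+ _]scaler_nat scalerA mulVf // scale1r.
Qed.

Lemma bary_mulmx_eq (m n : nat) (A : 'M[R]_(m, n)) (c : 'rV[R]_n) :
  apex_closed (@bary m) (fun x => x *m A = c).
Proof.
move=> s s0 sc; rewrite /bary -scalemxAl mulmx_suml.
by rewrite (eq_big_seq (fun=> c)) ?mean_const // => x /sc.
Qed.

Lemma bary_entry_ge0 (n : nat) (i : 'I_n) :
  apex_closed (@bary n) (fun x => 0 <= x 0 i).
Proof.
move=> s _ s0; rewrite /bary mxE mulr_ge0 ?invr_ge0 // summxE.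
by rewrite big_seq; apply: sumr_ge0.
Qed.

Lemma bary_ball (n : nat) (q : 'rV[R]_n) (r : R) :
  apex_closed (@bary n) (fun x => `|q - x| <= r).
Proof.
move=> s s0 sr; have k0 := size_unit s0.
have -> : q - bary s = (size s)%:R^-1 *: \sum_(x <- s) (q - x).
  by rewrite sumrB scalerBr mean_const.
rewrite normrZ ger0_norm ?invr_ge0 // ler_pdivrMl ?lt0r ?k0 //=.
apply: le_trans (ler_norm_sum _ _ _) _.
rewrite mulr_natl -iter_addr_0 -[X in iter X](count_predT s) -big_const_seq.
by rewrite big_seq [leRHS]big_seq; apply: ler_sum.
Qed.

Definition ratio (n : nat) : R := n%:R / n.+1%:R.

Lemma ratio_bounds n : 0 <= ratio n < 1.
Proof. by rewrite divr_ge0 //= ltr_pdivrMr // mul1r ltr_nat. Qed.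

(** With l points, the barycentre minus x is 1/l times the sum of all y - x; the term y = x
    vanishes, which leaves l - 1 terms of norm at most [D]. *)
Lemma bary_dist (n k : nat) (s : seq 'rV[R]_n) (D : R) : (size s <= k.+1)%N ->
  (forall x y, x \in s -> y \in s -> `|x - y| <= D) ->
  forall x, x \in s -> `|bary s - x| <= ratio k * D.
Proof.
move=> sk sD x xs; have s0 : s != [::] by case: (s) xs.
have D0 : 0 <= D by apply: le_trans (sD x x xs xs).
have k0 := size_unit s0.
have -> : bary s - x = (size s)%:R^-1 *: \sum_(y <- rem x s) (y - x).
  have -> : \sum_(y <- rem x s) (y - x) = \sum_(y <- s) (y - x).
    by rewrite [RHS](perm_big _ (perm_to_rem xs)) big_cons /= subrr add0r.
  by rewrite sumrB scalerBr mean_const.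
rewrite normrZ ger0_norm ?invr_ge0 // ler_pdivrMl ?lt0r ?k0 //=.
apply: le_trans (ler_norm_sum _ _ _) _.
apply: (@le_trans _ _ ((size s).-1%:R * D)).
  rewrite mulr_natl -iter_addr_0 -(size_rem xs).
  rewrite -[X in iter X](count_predT (rem x s)) -big_const_seq.
  rewrite big_seq [leRHS]big_seq; apply: ler_sum => y ys.
  by apply: sD xs; apply: mem_rem ys.
rewrite mulrA ler_wpM2r // /ratio mulrA ler_pdivlMr //.
rewrite -!natrM ler_nat; case: (size s) sk => //= l lk.
by rewrite mulnS mulSn leq_add2r.
Qed.

Lemma sd_mesh (n k : nat) (s : seq 'rV[R]_n) (D : R) : (size s <= k.+1)%N ->
  (forall x y, x \in s -> y \in s -> `|x - y| <= D) ->
  forall m, m \in sd (@bary n) s ->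
  forall x y, x \in m -> y \in m -> `|x - y| <= ratio k * D.
Proof.
have [l] := ubnP (size s); elim: l s => // l IH [|z s] le_sl sk sD m.
  by rewrite inE => /eqP->.
have D0 : 0 <= D by apply: le_trans (sD z z _ _); rewrite ?mem_head.
case/sd_consP => t [m' [ts m't ->]] x y.
have st := size_facets ts; rewrite st in le_sl sk.
have near w : w \in m' -> `|bary (z :: s) - w| <= ratio k * D.
  apply: (sd_closed (@bary_ball n (bary (z :: s)) (ratio k * D)) _ m't).
  move=> v vt; apply: bary_dist => //; first by rewrite st.
  exact: mem_facets vt.
rewrite !inE => /orP[/eqP->|xm] /orP[/eqP->|ym].
- by rewrite subrr normr0 mulr_ge0 //; case/andP: (ratio_bounds k).
- exact: near.
- by rewrite distrC; apply: near.
- apply: (IH t) m't _ _ xm ym => //; first exact: ltnW.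
  by move=> u v ut vt; apply: sD; [apply: mem_facets ut|apply: mem_facets vt].
Qed.

Lemma sds_mesh (n : nat) (s : seq 'rV[R]_n) (d : R) : 0 < d ->
  exists N0, forall N, (N0 <= N)%N -> forall m, m \in sds (@bary n) N s ->
    forall x y, x \in m -> y \in m -> `|x - y| < d.
Proof.
move=> d0; pose k := size s; pose D : R := \sum_(x <- s) \sum_(y <- s) `|x - y|.
have D0 : 0 <= D by apply: sumr_ge0 => x _; apply: sumr_ge0.
have sD x y : x \in s -> y \in s -> `|x - y| <= D.
  move=> xs ys; rewrite /D (perm_big _ (perm_to_rem xs)) big_cons /=.
  rewrite (perm_big _ (perm_to_rem ys)) big_cons /= -addrA lerDl.
  by rewrite addr_ge0 // ?sumr_ge0 // => i _; rewrite sumr_ge0.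
have mesh N m : m \in sds (@bary n) N s ->
    forall x y, x \in m -> y \in m -> `|x - y| <= ratio k ^+ N * D.
  have : (size s <= k.+1)%N by apply: leqnSn.
  clearbody D k; elim: N s D D0 sD => [|N IH] u D D0 uD uk.
    by rewrite expr0 mul1r inE => /eqP->.
  case/sdsS => t tu mt; rewrite exprSr -mulrA.
  apply: IH mt; first by rewrite mulr_ge0 //; case/andP: (ratio_bounds k).
    exact: sd_mesh tu.
  by rewrite (size_sd tu).
have [/andP[r0 r1]] := ratio_bounds k.
have [N0 hN] : exists N0, ratio k ^+ N0 * D < d.
  have := @cvg_expr R (ratio k); rewrite ger0_norm // => /(_ r1) /cvgrPdist_lt.
  (* [D + 1] rather than [D], which may be 0. *)
  have e0 : 0 < d / (D + 1) by rewrite divr_gt0 // ltr_wpDl.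
  move=> /(_ _ e0)[N0 _ /(_ N0 (leqnn _))] /=.
  rewrite sub0r normrN ger0_norm ?exprn_ge0 // ltr_pdivlMr ?ltr_wpDl // => h.
  exists N0; apply: le_lt_trans h; rewrite ler_wpM2l ?exprn_ge0 //.
  by rewrite lerDl.
exists N0 => N NN m mN x y xm ym; apply: le_lt_trans (mesh N m mN x y xm ym) _.
apply: le_lt_trans hN; rewrite ler_wpM2r //.
by apply: ler_wiXn2l => //; apply: ltW.
Qed.

End Barycentre.

(** * Chains modulo 2 on finite sets *)

Section Chains.
Variable V : finType.
Implicit Types (x y z : {set V} -> 'F_2) (s t u : {set V}) (v w : V).

(** Chains are functions on all sets, the empty one included, so this is the augmented boundary;
    conditions [t != set0] further on return to unreduced homology. *)
Definition bd x t : 'F_2 := \sum_(v | v \notin t) x (v |: t).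

Lemma sum_sym (g : V -> V -> 'F_2) : (forall v w, g v w = g w v) ->
  (forall v, g v v = 0) -> \sum_v \sum_w g v w = 0.
Proof.
move=> gC g0; pose r := @enum_rank V.
have -> : \sum_v \sum_w g v w = \sum_v \sum_(w | (r v < r w)%N) g v w +
    \sum_v \sum_(w | (r w < r v)%N) g v w.
  rewrite -big_split; apply: eq_bigr => v _ /=.
  rewrite (bigID (fun w => (r v < r w)%N)) /=; congr (_ + _).
  rewrite (bigD1 v) ?ltnn //= g0 add0r; apply: eq_bigl => w.
  rewrite -leqNgt ltn_neqAle andbC; congr (_ && _).
  by rewrite (inj_eq val_inj) (inj_eq enum_rank_inj).
rewrite -[RHS](addF2 (\sum_v \sum_(w | (r v < r w)%N) g v w)); congr (_ + _).
rewrite (exchange_big_dep predT) //=.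
by apply: eq_bigr => v _; apply: eq_bigr => w _.
Qed.

Lemma bd_bd x t : bd (bd x) t = 0.
Proof.
rewrite -[RHS](@sum_sym (fun v w => if [&& v \notin t, w \notin t & v != w]
  then x (v |: (w |: t)) else 0)).
- rewrite /bd big_mkcond; apply: eq_bigr => v _.
  case: ifP => vt; last by rewrite big1.
  rewrite big_mkcond; apply: eq_bigr => w _.
  rewrite !inE negb_or andbC eq_sym /=.
  by case: ifP => // _; rewrite setUCA.
- move=> v w; rewrite andbCA eq_sym; case: ifP => // _.
  by rewrite setUCA.
- by move=> v; rewrite eqxx !andbF.
Qed.

Lemma eq_bd x y : x =1 y -> bd x =1 bd y.
Proof. by move=> xy t; apply: eq_bigr. Qed.

Lemma bdD x y t : bd (fun s => x s + y s) t = bd x t + bd y t.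
Proof. exact: big_split. Qed.

Lemma bd_sets x t : bd x t =
  \sum_(s : {set V} | (t \subset s) && (#|s| == #|t|.+1)) x s.
Proof.
rewrite /bd (partition_big (fun v => v |: t)
  (fun s => (t \subset s) && (#|s| == #|t|.+1))) /=; last first.
  by move=> v vt; rewrite subsetUr cardsU1 vt /=.
apply: eq_bigr => s /andP[ts /eqP st].
have /eqP/cards1P[v sv] : #|s :\: t| = 1%N.
  by have := cardsID t s; rewrite (setIidPr ts) st; lia.
have vt : v \notin t by move/setP/(_ v): sv; rewrite !inE eqxx; case/andP.
have vs : v |: t = s.
  rewrite -sv; apply/setP => w; rewrite !inE.
  by case: (boolP (w \in t)) => [/(subsetP ts)->|_]; rewrite ?orbT ?orbF.
rewrite (big_pred1 v) ?vs // => w; apply/andP/eqP => [[wt /eqP ws]|->]; last first.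
  by rewrite vs.
by apply/set1P; rewrite -sv inE wt -ws setU11.
Qed.

Lemma bd_card x n t : (forall s, x s != 0 -> #|s| = n.+1) -> bd x t != 0 ->
  #|t| = n.
Proof.
move=> xn; apply: contraNeq => tn; rewrite /bd big1 // => v vt.
apply: contraNeq tn => /xn; rewrite cardsU1 vt add1n => -[->].
by rewrite eqxx.
Qed.

(* meant for [x] with no set containing [v] in its support *)
Definition cone v x t : 'F_2 := if v \in t then x (t :\ v) else 0.

Lemma bd_cone v x t : (forall s, v \in s -> x s = 0) ->
  bd (cone v x) t = x t + cone v (bd x) t.
Proof.
move=> xv; rewrite /cone; case: ifP => vt.
  rewrite xv // add0r /bd (bigID (mem (t :\ v))) /= big1 ?add0r; last first.
    by move=> w /andP[wt]; rewrite inE (negPf wt) andbF.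
  rewrite [RHS](bigD1 v) ?setD11 //= xv ?setU11 // add0r.
  apply: eq_big => w.
    rewrite !inE; case: (altP (w =P v)) => [->|] /=; first by rewrite vt.
    by case: (w \in t).
  case/andP => wt _; rewrite inE vt orbT; congr x.
  rewrite setDUl; congr (_ :|: _); apply/setDidPl.
  by rewrite disjoints1 inE; apply: contraNneq wt => ->.
rewrite addr0 /bd (bigD1 v) ?vt //= setU11 big1 => [|w /andP[wt wv]].
  by rewrite addr0 setU1K // vt.
by rewrite !inE vt orbF eq_sym (negPf wv).
Qed.

End Chains.

(** * Free pairs and cycles in the link of a vertex *)

Section LinkStep.
Variables (V : finType) (L : {set {set V}}).
Hypotheses (L0 : set0 \in L)
  (L_down : forall s t : {set V}, s \in L -> t \subset s -> t \in L).
Implicit Types (s t e : {set V}) (v w : V).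

(** An elementary collapse. As [L] contains the empty face, a lone point and the empty face form
    such a pair. *)
Definition free_pair s t := [/\ s \in L, t \in L, s \subset t, #|t| = #|s|.+1 &
  forall u, u \in L -> s \subset u -> u = s \/ u = t].

(** [z] is a reduced cycle, its boundary vanishing at the empty set as well; maximality of [s] lets
    it be removed alone. *)
Definition critical_cell s (z : {set V} -> 'F_2) := [/\ s \in L, z s = 1,
  forall u, u \in L -> s \subset u -> u = s,
  forall u, z u != 0 -> u \in L /\ #|u| = #|s| & forall t, bd z t = 0].

Definition reducible :=
  (exists s t, free_pair s t) \/ (exists s z, critical_cell s z).

Definition cofaces n e := [set t in L | (#|t| == n.+1) && (e \subset t)].

Lemma free_reducible n e : (forall s, s \in L -> (#|s| <= n.+1)%N) ->
  #|e| = n -> #|cofaces n e| = 1%N -> reducible.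
Proof.
move=> Ln en /eqP/cards1P[t et]; left; exists e, t.
have : t \in cofaces n e by rewrite et set11.
rewrite inE => /and3P[tL /eqP tn sub]; split => //; rewrite ?en //.
  exact: L_down sub.
move=> u uL eu; have [le|gt] := leqP #|u| n.
  by left; apply/eqP; rewrite eq_sym eqEcard eu en.
right; apply/set1P; rewrite -et inE uL eu andbT /=.
by rewrite eqn_leq gt Ln.
Qed.

Lemma cycle_reducible n z : (forall s, s \in L -> (#|s| <= n)%N) ->
  (forall u, z u != 0 -> u \in L /\ #|u| = n) -> (forall t, bd z t = 0) ->
  (exists s, z s != 0) -> reducible.
Proof.
move=> Ln zL dz [s zs]; have [sL sn] := zL s zs; right; exists s, z; split=> //.
- exact: F2_neq0.
- move=> u uL su; apply/eqP; rewrite eq_sym eqEcard su sn; exact: Ln.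
- by move=> u /zL[-> ->].
Qed.

Lemma bd_indicator n t : #|t| = n ->
  bd (fun s => ((s \in L) && (#|s| == n.+1))%:R) t = #|cofaces n t|%:R.
Proof.
move=> tn; rewrite bd_sets tn -sum1_card natr_sum [RHS]big_mkcond [LHS]big_mkcond.
apply: eq_bigr => s _; rewrite inE.
by case: (t \subset s); case: (s \in L); case: (#|s| == n.+1).
Qed.

Lemma bd_support_card n z t : (forall s, z s != 0 -> #|s| = n.+1) ->
  #|t| != n -> bd z t = 0.
Proof. by move=> zn tn; apply/eqP; apply: contraNT tn => /(bd_card zn)->. Qed.

(** Without free faces each [e] lies in no or in two top faces, so the sum of all top faces is a
    cycle modulo 2. *)
Lemma even_cofaces_reducible n : (forall s, s \in L -> (#|s| <= n.+1)%N) ->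
  (exists2 s, s \in L & #|s| = n.+1) ->
  (forall e, #|e| = n -> (#|cofaces n e| <= 2)%N) -> reducible.
Proof.
move=> Ln [s sL sn] co2.
case: (boolP [exists e : {set V}, (#|e| == n) && (#|cofaces n e| == 1%N)]).
  by case/existsP => e /andP[/eqP en /eqP]; apply: free_reducible.
move=> /existsPn no1.
apply: (@cycle_reducible n.+1
  (fun s => ((s \in L) && (#|s| == n.+1))%:R)) => //.
- by move=> u /F2_bool/andP[-> /eqP->].
- move=> t; case: (altP (#|t| =P n)) => tn; last first.
    by apply: bd_support_card tn => u /F2_bool/andP[_ /eqP].
  rewrite bd_indicator //; have := no1 t; rewrite tn eqxx /=.
  have := co2 t tn; case: #|cofaces n t| => [|[|[|//]]] // _ _.
  exact: (addF2 1).
- by exists s; rewrite sL sn eqxx.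
Qed.

(** Degrees are not bounded here, so the sum of all edges may fail to be a cycle; a cycle is found
    by counting dimensions instead. *)
Lemma graph_reducible : (forall s, s \in L -> (#|s| <= 2)%N) ->
  (exists2 s, s \in L & #|s| = 2%N) -> reducible.
Proof.
move=> L2 [s0 s0L s02].
case: (boolP [exists e : {set V}, (#|e| == 1%N) && (#|cofaces 1 e| == 1%N)]).
  by case/existsP => e /andP[/eqP en /eqP]; apply: free_reducible.
move=> /existsPn no1.
pose A := [set s in L | #|s| == 2%N].
pose W := [set v | cofaces 1 [set v] != set0].
have degA v : cofaces 1 [set v] = [set s in A | v \in s].
  by apply/setP => s; rewrite !inE sub1set andbA.
have sum_deg : (\sum_(v in W) #|cofaces 1 [set v]| = 2 * #|A|)%N.
  transitivity (\sum_(v : V) #|cofaces 1 [set v]|)%N.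
    rewrite [RHS](bigID (mem W)) /= [X in (_ + X)%N]big1 ?addn0 // => v.
    by rewrite inE negbK => /eqP->; rewrite cards0.
  under eq_bigr do rewrite degA -sum1_card.
  transitivity (\sum_(s in A) #|s|)%N; last first.
    rewrite (eq_bigr (fun=> 2%N)); first by rewrite sum_nat_const mulnC.
    by move=> s; rewrite inE => /andP[_ /eqP].
  rewrite (exchange_big_dep (mem A)) /=; last by move=> v s _; rewrite inE => /andP[].
  apply: eq_bigr => s sA; rewrite -sum1_card; apply: eq_bigl => v.
  by rewrite inE sA.
have WA : (#|W| <= #|A|)%N.
  rewrite -(leq_pmul2l (m := 2)) // -sum_deg mulnC -sum_nat_const.
  apply: leq_sum => v; rewrite inE -card_gt0.
  by have := no1 [set v]; rewrite cards1 eqxx /=; case: #|cofaces 1 _| => [|[|]].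
have [v0 v0W] : exists v, v \in W.
  have /card_gt0P[v vs] : (0 < #|s0|)%N by rewrite s02.
  exists v; rewrite inE; apply/set0Pn; exists s0.
  by rewrite inE s0L s02 sub1set vs.
(* Each of the vertices [W] lies on two edges or more, so there are more edges
   than vertices other than [v0], and some chain has its boundary inside [v0];
   that boundary vanishes because its number of vertices is even. *)
pose M : 'M['F_2]_(#|A|, #|W :\ v0|) :=
  \matrix_(a < #|A|, b < #|W :\ v0|) (enum_val b \in enum_val a)%:R.
have kM : kermx M != 0.
  rewrite -mxrank_eq0 mxrank_ker subn_eq0 -ltnNge.
  apply: leq_ltn_trans (rank_leq_col _) _.
  by apply: leq_trans WA; rewrite [#|W|](cardsD1 v0) v0W.
have [y yM y0] := rowV0Pn kM; have {}yM : y *m M = 0 by apply/sub_kermxP.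
pose z (s : {set V}) : 'F_2 := \sum_(a < #|A| | enum_val a == s) y 0 a.
have zv a : z (enum_val a) = y 0 a.
  by rewrite /z (big_pred1 a) // => a'; rewrite (inj_eq enum_val_inj).
have zA s : z s != 0 -> s \in A.
  apply: contraNT => sA; apply/eqP; apply: big1 => a /eqP as_.
  by have := enum_valP a; rewrite as_ (negPf sA).
have zL s : z s != 0 -> s \in L /\ #|s| = 2%N by move/zA; rewrite inE => /andP[? /eqP].
have z2 s : z s != 0 -> #|s| = 2%N by move/zL => [].
have bdz v : bd z [set v] = \sum_(a < #|A|) y 0 a * (v \in enum_val a)%:R.
  under eq_bigr do rewrite -zv.
  rewrite -(big_enum_val (fun s => z s * (v \in s)%:R)) /=.
  rewrite bd_sets cards1 [LHS]big_mkcond [RHS]big_mkcond; apply: eq_bigr => s _.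
  rewrite inE sub1set; case: (altP (#|s| =P 2%N)) => s2; rewrite ?andbF //.
  rewrite !andbT; case: (v \in s); rewrite ?mulr1 ?mulr0 ?if_same //.
  by case: ifPn => // sL; apply/eqP; apply: contraNT sL => /zL[].
have bdz1 v : v != v0 -> bd z [set v] = 0.
  move=> vv0; case: (boolP (v \in W)) => vW.
    have vb : v \in W :\ v0 by rewrite in_setD1 vv0.
    move/rowP/(_ (enum_rank_in vb v)): yM; rewrite mxE [RHS]mxE => yM.
    by rewrite bdz -[RHS]yM; apply: eq_bigr => a _; rewrite mxE enum_rankK_in.
  rewrite bdz big1 // => a _; case: (boolP (v \in enum_val a)); rewrite ?mulr0 // => va.
  case/negP: vW; rewrite inE; apply/set0Pn; exists (enum_val a).
  by rewrite degA inE va enum_valP.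
apply: (@cycle_reducible 2 z) => //; last first.
  have /rV0Pn[a ya] := y0; exists (enum_val a).
  by rewrite zv.
move=> t; case: (altP (#|t| =P 1%N)) => t1; last exact: bd_support_card t1.
have /cards1P[v ->] := introT eqP t1.
case: (altP (v =P v0)) => [->|/bdz1//].
have := bd_bd z set0; rewrite {1}/bd (bigD1 v0) ?inE //= setU0 big1 ?addr0 //.
by move=> w /andP[_ /bdz1]; rewrite setU0.
Qed.

(** A single point pairs with the empty face; otherwise the sum of two points is a reduced cycle. *)
Lemma points_reducible : (forall s, s \in L -> (#|s| <= 1)%N) ->
  (exists2 s, s \in L & #|s| = 1%N) -> reducible.
Proof.
move=> L1 [s sL /eqP/cards1P[v sv]]; rewrite {}sv in sL.
case: (altP (#|cofaces 0 set0| =P 1%N)) => [c1|n1].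
  by apply: (free_reducible (n := 0) _ _ c1); rewrite ?cards0.
have cof w : ([set w] \in cofaces 0 set0) = ([set w] \in L).
  by rewrite inE cards1 sub0set eqxx !andbT.
have [w wv wL] : exists2 w, w != v & [set w] \in L.
  have /set0Pn[t] : cofaces 0 set0 :\ [set v] != set0.
    by apply: contra n1; rewrite -cards_eq0 (cardsD1 [set v] (cofaces _ _)) cof sL => /eqP->.
  rewrite !inE => /and4P[tv tL /cards1P[w tw] _]; exists w; rewrite -?tw //.
  by apply: contraNneq tv => <-; rewrite tw.
apply: (@cycle_reducible 1 (fun s => (s == [set v])%:R + (s == [set w])%:R)) => //.
- move=> u; case: (altP (u =P [set v])) => [->|_]; first by rewrite sL cards1.
  by case: (altP (u =P [set w])) => [->|_]; rewrite ?wL ?cards1 // addr0 eqxx.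
- move=> t; have [->|/set0Pn[u ut]] := eqVneq t set0.
    rewrite bdD -[RHS](addF2 1) /bd; congr (_ + _).
      rewrite (bigD1 v) ?inE //= setU0 eqxx big1 ?addr0 // => u /andP[_ uv].
      by rewrite setU0 (inj_eq set1_inj) (negPf uv).
    rewrite (bigD1 w) ?inE //= setU0 eqxx big1 ?addr0 // => u /andP[_ uv].
    by rewrite setU0 (inj_eq set1_inj) (negPf uv).
  apply: (@bd_support_card 0); last by rewrite cards_eq0; apply/set0Pn; exists u.
  move=> r; case: (altP (r =P [set v])) => [->|_]; first by rewrite cards1.
  by case: (altP (r =P [set w])) => [->|_]; rewrite ?cards1 // addr0 eqxx.
- exists [set v]; rewrite eqxx (inj_eq set1_inj) [v == w]eq_sym (negPf wv) addr0.
  exact: oner_neq0.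
Qed.

(** The empty face alone is a cycle. Applied to the link of a vertex, this case makes that vertex
    critical. *)
Lemma empty_reducible : (forall s, s \in L -> #|s| = 0%N) -> reducible.
Proof.
move=> Ln; apply: (@cycle_reducible 0 (fun s => (s == set0)%:R)).
- by move=> s /Ln->.
- by move=> u /F2_bool/eqP->; rewrite cards0.
- move=> t; apply: big1 => v vt.
  by rewrite -cards_eq0 cardsU1 vt add1n.
- by exists set0; rewrite eqxx.
Qed.

Lemma link_reducible : (forall s, s \in L -> (#|s| <= 3)%N) ->
  (forall e, #|e| = 2%N -> (#|cofaces 2 e| <= 2)%N) -> reducible.
Proof.
move=> L3 co2.
have drop n : (forall s, s \in L -> (#|s| <= n.+1)%N) ->
    (exists2 s, s \in L & #|s| = n.+1) \/ (forall s, s \in L -> (#|s| <= n)%N).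
  move=> Ln; case: (boolP [exists s in L, #|s| == n.+1]).
    by case/exists_inP => s sL /eqP; left; exists s.
  move/exists_inPn => no; right => s sL; rewrite -ltnS ltn_neqAle no //.
  exact: Ln.
have [|L2] := drop _ L3; first by move/even_cofaces_reducible; apply.
have [|L1] := drop _ L2; first exact: graph_reducible.
have [|L00] := drop _ L1; first exact: points_reducible.
by apply: empty_reducible => s /L00; rewrite leqn0 => /eqP.
Qed.

End LinkStep.

(** * Discrete Morse functions with a cycle ending at each critical face *)

Section Morse.
Variable V : finType.
Implicit Types (s t u : {set V}) (A : {set {set V}}) (f : {set V} -> nat).

(** The cycles are those of unreduced homology, whence no condition at the empty set. *)
Definition ends_cycle A f s := exists z : {set V} -> 'F_2,
  [/\ z s = 1, forall t, z t != 0 -> [/\ t \in A, #|t| = #|s| & (f t <= f s)%N] &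
      forall t, t != set0 -> bd z t = 0].

(** Faces with a common value differ by one vertex, so at most two share it. New faces will receive
    larger values, which leaves the earlier cycles intact. *)
Definition perfect_order A f :=
  [/\ {in A &, forall s t, s \subset t -> (f s <= f t)%N},
      {in A &, forall s t, s != t -> f s = f t ->
        (s \subset t) && (#|t| == #|s|.+1) || (t \subset s) && (#|s| == #|t|.+1)} &
      {in A, forall s, (forall t, t \in A -> t != s -> f t != f s) ->
        ends_cycle A f s}].

Section Extension.
Variables (A : {set {set V}}) (f : {set V} -> nat).
Hypothesis gA : perfect_order A f.

Let top := (\max_s f s).+1.
Let f_top s : (f s < top)%N. Proof. exact: leq_bigmax. Qed.

Lemma perfect_order_critical s (z : {set V} -> 'F_2) : s \notin A ->
  (forall t, t \in A -> ~~ (s \subset t)) ->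
  z s = 1 -> (forall t, z t != 0 -> (t \in s |: A) /\ #|t| = #|s|) ->
  (forall t, t != set0 -> bd z t = 0) -> exists g, perfect_order (s |: A) g.
Proof.
move=> sA smax zs zA dz; have [mono lev crit] := gA.
pose g t := if t == s then top else f t.
have gs : g s = top by rewrite /g eqxx.
have gf t : t \in A -> g t = f t.
  by move=> tA; rewrite /g; case: eqP => // ts; rewrite -ts tA in sA.
have g_le t : (g t <= top)%N by rewrite /g; case: ifP => // _; apply: ltnW.
exists g; split.
- move=> t u; rewrite !inE => /orP[/eqP->|tA] /orP[/eqP->|uA] tu //.
    by move: (smax u uA); rewrite tu.
  by rewrite gs g_le.
  by rewrite !gf //; apply: mono.
- move=> t u; rewrite !inE => /orP[/eqP->|tA] /orP[/eqP->|uA].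
  + by rewrite eqxx.
  + by move=> _; rewrite gs gf // => e; have := f_top u; rewrite -e ltnn.
  + by move=> _; rewrite gs gf // => e; have := f_top t; rewrite e ltnn.
  + by rewrite !gf //; apply: lev.
- move=> t; rewrite !inE => /orP[/eqP->|tA] alone.
    exists z; split=> // u /zA[uA us]; split=> //.
    by rewrite gs g_le.
  have [|y [yt yA dy]] := crit t tA.
    by move=> u uA ut; rewrite -!gf // alone // setU1r.
  exists y; split=> // u /yA[uA ut fut]; split; rewrite ?gf ?setU1r //.
Qed.

Lemma perfect_order_pair s t : s \notin A -> t \notin A -> s \subset t ->
  #|t| = #|s|.+1 -> (forall u, u \in A -> ~~ (s \subset u)) ->
  exists g, perfect_order (s |: (t |: A)) g.
Proof.
move=> sA tA st cst smax; have [mono lev crit] := gA.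
pose g u := if (u == s) || (u == t) then top else f u.
have gs : g s = top by rewrite /g eqxx.
have gt : g t = top by rewrite /g eqxx orbT.
have ts : t != s by apply: contra_eq_neq cst => ->; rewrite ltn_eqF.
have gf u : u \in A -> g u = f u.
  move=> uA; rewrite /g; case: eqP => [us|_] /=; first by rewrite -us uA in sA.
  by case: eqP => // ut; rewrite -ut uA in tA.
have g_le u : (g u <= top)%N by rewrite /g; case: ifP => // _; apply: ltnW.
have gB u : u \in s |: (t |: A) -> [\/ u = s, u = t | u \in A].
  by rewrite !inE => /or3P[/eqP->|/eqP->|->]; [constructor 1|constructor 2|constructor 3].
have tmax u : u \in A -> ~~ (t \subset u).
  by move=> /smax; apply: contra; apply: subset_trans.
have notop u : u \in A -> g u <> top.
  by move=> uA; rewrite gf // => e; have := f_top u; rewrite e ltnn.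
exists g; split.
- move=> u v /gB[->|->|uA] /gB[->|->|vA] uv; rewrite ?gs ?gt ?g_le //.
  + by move: (smax v vA); rewrite uv.
  + by move: (tmax v vA); rewrite uv.
  + by rewrite !gf //; apply: mono.
- move=> u v /gB[->|->|uA] /gB[->|->|vA]; rewrite ?eqxx ?gs ?gt // => uv.
  + by rewrite st cst eqxx.
  + by move/esym/notop; case.
  + by rewrite st cst eqxx orbT.
  + by move/esym/notop; case.
  + by move/notop; case.
  + by move/notop; case.
  + by rewrite !gf //; apply: lev.
- move=> u /gB[->|->|uA] alone.
  + by have := alone t; rewrite gs gt eqxx !inE eqxx orbT ts => /(_ isT isT).
  + by have := alone s; rewrite gs gt eqxx !inE eqxx eq_sym ts => /(_ isT isT).
  have sub v : v \in A -> v \in s |: (t |: A) by move=> vA; rewrite !inE vA !orbT.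
  have [|y [yt yA dy]] := crit u uA.
    by move=> v vA vu; rewrite -!gf // alone // sub.
  by exists y; split=> // v /yA[vA vu fvu]; split; rewrite ?gf ?sub.
Qed.

End Extension.

(** * Counting critical faces by ranks of boundary matrices *)

Section Perfect.
Variables (C : {set {set V}}) (f : {set V} -> nat).
Hypotheses (C_complex : simplicial_complex C) (gC : perfect_order C f).

Let C0 : set0 \notin C. Proof. by case: C_complex. Qed.
Let mono := let: And3 h _ _ := gC in h.
Let lev := let: And3 _ h _ := gC in h.
Let crit := let: And3 _ _ h := gC in h.

Lemma level_inj s t : s \in C -> t \in C -> #|s| = #|t| -> f s = f t -> s = t.
Proof.
move=> sC tC st fst; apply/eqP/negPn/negP => /(lev sC tC)/(_ fst).
by rewrite st; case/orP => /andP[_ /eqP]; lia.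
Qed.

(** Three cardinals cannot differ pairwise by exactly one. *)
Lemma level_pair (s t u : {set V}) : s \in C -> t \in C -> u \in C ->
  f t = f s -> f u = f s -> [|| s == t, s == u | t == u].
Proof.
move=> sC tC uC fts fus; apply: contraT; rewrite !negb_or => /and3P[st su tu].
have := lev sC tC st (esym fts); have := lev sC uC su (esym fus).
have := lev tC uC tu; rewrite fts fus => /(_ erefl).
by do 3 case/orP => /andP[_ /eqP ?]; lia.
Qed.

Definition upper := [set s in C | [exists t in C, [&& t != s, t \subset s & f t == f s]]].

Definition partner s := odflt s [pick t in C | (t != s) && (f t == f s)].

Lemma partnerE s t : s \in C -> t \in C -> t != s -> f t = f s -> partner s = t.
Proof.
move=> sC tC ts fts; rewrite /partner; case: pickP => [u|/(_ t)]; last first.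
  by rewrite tC ts fts eqxx.
case/and3P => uC us /eqP fus /=.
by have := level_pair sC tC uC fts fus; rewrite eq_sym (negPf ts) eq_sym (negPf us) => /eqP.
Qed.

Lemma upper_partner s : s \in upper -> exists t,
  [/\ t \in C, t \subset s, #|s| = #|t|.+1 & f t = f s].
Proof.
rewrite inE => /andP[sC /exists_inP[t tC /and3P[ts sub /eqP fts]]].
exists t; split=> //.
case/orP: (lev tC sC ts fts) => /andP[st /eqP//].
by have := subset_leq_card sub; lia.
Qed.

(** For the lower face of a pair the cycle is the boundary of its partner, all of whose faces have
    at most the common value. *)
Lemma not_upper_cycle s : s \in C -> s \notin upper -> ends_cycle C f s.
Proof.
move=> sC sU; case: (boolP [exists t in C, (t != s) && (f t == f s)]); last first.
  move/exists_inPn => alone; apply: crit => // t tC ts.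
  by have := alone t tC; rewrite ts.
case/exists_inP => t tC /andP[ts /eqP fts].
have nts : ~~ (t \subset s).
  apply: contra sU => sub; rewrite inE sC; apply/exists_inP; exists t => //.
  by rewrite ts sub fts eqxx.
have := lev tC sC ts fts; rewrite (negPf nts) /= => /andP[st /eqP cst].
exists (bd (fun u => (u == t)%:R)).
have dt u : bd (fun u => (u == t)%:R) u = ((u \subset t) && (#|t| == #|u|.+1))%:R.
  rewrite bd_sets; case: (boolP ((u \subset t) && (#|t| == #|u|.+1))) => h.
    rewrite (bigD1 t) //= eqxx big1 ?addr0 // => v /andP[_ /negPf->//].
  by rewrite big1 // => v vh; case: eqP => // vt; rewrite -vt vh in h.
split=> [|u|u _]; last exact: bd_bd.
  by rewrite dt st cst eqxx.
rewrite dt => /F2_bool/andP[ut /eqP cu].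
have us : #|u| = #|s| by move: cu; rewrite cst => -[].
have uC : u \in C.
  have [_] := C_complex; apply; first exact: tC; last by [].
  by rewrite -card_gt0 us card_gt0; apply: contraNneq C0 => <-.
by split=> //; rewrite -fts; apply: mono.
Qed.

Section Rank.
Variable n : nat.
Let M := boundary_mx C n.+1.
Let U := upper :&: faces C n.+1.
Let B : 'M['F_2]_(#|U|, #|faces C n|) :=
  \matrix_(a < #|U|, b < #|faces C n|) (enum_val b \subset enum_val a)%:R.

Lemma chain_boundary (z : {set V} -> 'F_2) t :
  (forall s, z s != 0 -> s \in faces C n.+1) -> t \in faces C n ->
  bd z t = \sum_(a < #|faces C n.+1|) z (enum_val a) * (t \subset enum_val a)%:R.
Proof.
move=> zC; rewrite inE => /andP[tC /eqP tn].
rewrite -(big_enum_val (fun s => z s * (t \subset s)%:R)) bd_sets tn.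
rewrite [LHS]big_mkcond [RHS]big_mkcond; apply: eq_bigr => s _.
case: (boolP (s \in faces C n.+1)) => sC.
  by move: sC; rewrite inE => /andP[_ ->]; case: (t \subset s); rewrite ?mulr1 ?mulr0.
by case: ifP => // _; apply/eqP; apply: contraNT sC => /zC.
Qed.

Lemma rowU a (h : enum_val a \in U) : row a M = row (enum_rank_in h (enum_val a)) B.
Proof. by apply/rowP => b; rewrite !mxE enum_rankK_in. Qed.

(** The cycle ending at a face that is not upper expresses its row by rows of smaller value; by
    induction on the value the upper rows span. *)
Lemma boundary_rank_le : (\rank M <= #|U|)%N.
Proof.
apply: leq_trans (rank_leq_row B); apply: mxrankS; apply/row_subP => a.
have [k] := ubnP (f (enum_val a)); elim: k a => // k IH a.
rewrite ltnS; have := enum_valP a; move sa: (enum_val a) => s sF fk.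
case: (boolP (s \in upper)) => [sU|sU].
  have h : enum_val a \in U by rewrite sa inE sU.
  by rewrite (rowU h) row_sub.
have sC : s \in C by move: sF; rewrite inE => /andP[].
have sn : #|s| = n.+1 by move: sF; rewrite inE => /andP[_ /eqP].
have [z [zs zC dz]] := not_upper_cycle sC sU.
have zF t : z t != 0 -> t \in faces C n.+1.
  by move=> /zC[tC ts _]; rewrite inE tC ts sn eqxx.
have -> : row a M = - \sum_(c | c != a) z (enum_val c) *: row c M.
  apply/eqP; rewrite -addr_eq0; apply/eqP/rowP => b.
  rewrite [RHS]mxE -(dz (enum_val b)); last first.
    by apply: contraNneq C0 => <-; have := enum_valP b; rewrite inE => /andP[].
  rewrite (chain_boundary zF (enum_valP b)) [RHS](bigD1 a) //= sa zs mul1r.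
  by rewrite !mxE sa summxE; congr (_ + _); apply: eq_bigr => c _; rewrite !mxE.
rewrite eqmx_opp; apply: summx_sub => c ca.
have [->|zc] := eqVneq (z (enum_val c)) 0; first by rewrite scale0r sub0mx.
apply: scalemx_sub; apply: IH; have [cC cs fc] := zC _ zc.
apply: leq_trans fk; rewrite ltn_neqAle fc andbT.
apply: contra ca => /eqP/(level_inj cC sC cs); rewrite -sa.
by move/enum_val_inj->.
Qed.

(** In a relation between upper rows take the face of largest value and the column of its lower
    partner. Any face of the relation that contains this partner has at least the same value, hence
    is the same face. *)
Lemma boundary_rank_ge : (#|U| <= \rank M)%N.
Proof.
suff /eqP <- : row_free B.
  apply: mxrankS; apply/row_subP => a.
  have [sU sF] := setIP (enum_valP a).
  have -> : row a B = row (enum_rank_in sF (enum_val a)) M.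
    by apply/rowP => b; rewrite !mxE enum_rankK_in.
  exact: row_sub.
apply: inj_row_free => y yB; apply/eqP; apply: contraT => /rV0Pn[a0 ya0].
case: (arg_maxnP (fun a => f (enum_val a)) (P := fun a => y 0 a != 0) ya0) => a ya amax.
have [sU sF] := setIP (enum_valP a).
have [t [tC ts cst fts]] := upper_partner sU.
have tF : t \in faces C n.
  by rewrite inE tC; move: sF; rewrite inE cst => /andP[_].
move/rowP/(_ (enum_rank_in tF t)): yB; rewrite mxE [RHS]mxE (bigD1 a) //= big1.
  by rewrite addr0 mxE enum_rankK_in // ts mulr1 => y0; rewrite y0 eqxx in ya.
move=> c ca; have [->|yc] := eqVneq (y 0 c) 0; first by rewrite mul0r.
rewrite mxE enum_rankK_in //; case: (boolP (t \subset _)) => tc; rewrite ?mulr0 //.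
have [cU cF] := setIP (enum_valP c).
have cC : enum_val c \in C by move: cF; rewrite inE => /andP[].
have sC : enum_val a \in C by move: sF; rewrite inE => /andP[].
case/eqP: ca; apply/enum_val_inj/level_inj => //.
  by move: sF cF; rewrite !inE => /andP[_ /eqP->] /andP[_ /eqP->].
apply/eqP; rewrite eqn_leq -{2}fts (mono tC cC tc) andbT; exact: amax.
Qed.

Lemma boundary_rank : \rank M = #|upper :&: faces C n.+1|.
Proof. by apply/eqP; rewrite eqn_leq boundary_rank_le boundary_rank_ge. Qed.

End Rank.

Lemma criticalE s : s \in C -> critical C (fun s => (f s)%:Z) s =
  [forall t in C, (t != s) ==> (f t != f s)].
Proof.
move=> sC; apply/forall_inP/forall_inP => h t tC; apply/implyP.
  move=> ts; apply/eqP => fts; have := h t tC; rewrite ts /= fts eqxx implybF.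
  by case/orP: (lev tC sC ts fts) => /andP[-> _]; rewrite ?orbT.
by case/andP => ts _; have := h t tC; rewrite ts.
Qed.

Lemma perfect_order_perfect : discrete_morse C (fun s => (f s)%:Z) /\ perfect C (fun s => (f s)%:Z).
Proof.
split; first split.
- by move=> s t sC tC st; rewrite lez_nat; apply: mono.
- move=> z; rewrite leqNgt; apply/negP => /card_gt2P[s [t [u [[]]]]].
  rewrite !inE => /andP[sC /eqP fs] /andP[tC /eqP ft] /andP[uC /eqP fu] [st tu us].
  have [fts] : (f t)%:Z = (f s)%:Z by rewrite fs ft.
  have [fus] : (f u)%:Z = (f s)%:Z by rewrite fs fu.
  have := level_pair sC tC uC fts fus.
  by rewrite (negPf st) (negPf tu) eq_sym (negPf us).
move=> i; rewrite /betti mxrank_ker !boundary_rank.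
set F := faces C i.+1.
(* The Betti number is now #|F| minus the numbers of upper faces of this dimension and of the next.
   [partner] matches the latter with the lower faces of this dimension, so the critical faces
   remain. *)
pose lower := [set s in F | [exists t in C, [&& t != s, s \subset t & f t == f s]]].
have FC s : s \in F -> s \in C by rewrite inE => /andP[].
have <- : #|lower| = #|upper :&: faces C i.+2|.
  have pl s : s \in lower -> exists t, [/\ t \in C /\ t != s, f t = f s,
      s \subset t, #|t| = i.+2 & partner s = t].
    rewrite inE => /andP[sF /exists_inP[t tC /and3P[ts sub /eqP fts]]].
    exists t; split=> //; last exact: partnerE (FC _ sF) tC ts fts.
    have : #|s| = i.+1 by move: sF; rewrite inE => /andP[_ /eqP].
    have := subset_leq_card sub.
    by case/orP: (lev tC (FC _ sF) ts fts) => /andP[_ /eqP]; lia.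
  rewrite -(card_in_imset (f := partner) (D := mem lower)); last first.
    move=> s s' sl sl'; have [t [[tC ts] ft st ct ->]] := pl s sl.
    have [t' [[tC' ts'] ft' st' ct' ->]] := pl s' sl' => tt'.
    have [sF sF'] : s \in F /\ s' \in F by move: sl sl'; rewrite !inE => /andP[-> _] /andP[->].
    apply: level_inj; rewrite ?FC //; last by rewrite -ft -ft' tt'.
    by move: sF sF'; rewrite !inE => /andP[_ /eqP->] /andP[_ /eqP->].
  apply: eq_card => t; apply/imsetP/idP.
    case=> s sl ->; have [t' [[tC ts] ft st ct ->]] := pl s sl.
    rewrite !inE tC ct eqxx /= !andbT; apply/exists_inP; exists s.
      by apply: FC; move: sl; rewrite inE => /andP[].
    by rewrite eq_sym ts st ft eqxx.
  case/setIP => tU; rewrite inE => /andP[tC /eqP ct].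
  have [s [sC st cts fst]] := upper_partner tU.
  have sni : s != t by apply: contra_eq_neq cts => ->; rewrite ltn_eqF.
  exists s; last by rewrite (partnerE sC tC) // eq_sym.
  rewrite !inE sC -eqSS -cts ct eqxx; apply/exists_inP; exists t => //.
  by rewrite eq_sym sni st fst eqxx.
rewrite -[#|F|](cardsID upper) setIC addnC addnK -(cardsID lower (F :\: upper)) addnC.
have -> : (F :\: upper) :&: lower = lower.
  apply/setIidPr/subsetP => s; rewrite inE => /andP[sF /exists_inP[t tC]].
  case/and3P => ts st /eqP fts; have sC := FC _ sF; rewrite 2!inE sF sC andbT /=.
  apply/exists_inPn => u uC; apply/negP => /and3P[us su /eqP fus].
  have := level_pair sC tC uC fts fus; rewrite eq_sym (negPf ts) eq_sym (negPf us) /=.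
  by move/eqP=> tu; case/eqP: us; apply/eqP; rewrite eqEsubset su -tu.
rewrite addnK; apply: eq_card => s; rewrite !inE.
case: (boolP (s \in C)) => //= sC; case: eqP => //= _; last by rewrite andbF.
rewrite criticalE // andbT; apply/forall_inP/andP => [alone|].
  by split; apply/exists_inPn => t tC; apply/negP => /and3P[ts st ft];
    have := alone t tC; rewrite ts ft.
case=> /exists_inPn nl /exists_inPn nu t tC; apply/implyP => ts; apply/eqP => fts.
have := nl t tC; have := nu t tC; rewrite ts fts eqxx /= !andbT.
by case/orP: (lev tC sC ts fts) => /andP[-> _].
Qed.

End Perfect.

End Morse.

(** * Dismantling a tight complex *)

Section TightComplex.
Variables (V : finType) (R : realType) (C : {set {set V}}) (ht : V -> R).
Hypothesis C_complex : simplicial_complex C.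
Implicit Types (s t u : {set V}) (A : {set {set V}}).

Definition above (a : R) : {set {set V}} :=
  [set s in C | [forall u in s, a < ht u]].

(** Injectivity of H_n of the part above level [a] into H_n of [C], in simplicial terms. *)
Definition tight_at (a : R) := forall n (z w : {set V} -> 'F_2),
  (forall s, z s != 0 -> s \in above a /\ #|s| = n.+1) ->
  (forall s, w s != 0 -> s \in C /\ #|s| = n.+2) ->
  (forall t, bd w t = z t) ->
  exists w', (forall s, w' s != 0 -> s \in above a /\ #|s| = n.+2) /\
             forall t, bd w' t = z t.

Hypotheses (dimC : forall s, s \in C -> (#|s| <= 4)%N)
  (pseudo : forall t, #|t| = 3%N -> (#|cofaces C 3 t| <= 2)%N)
  (ht_inj : forall u v : V, [set u] \in C -> [set v] \in C -> u != v -> ht u != ht v)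
  (tight_ht : forall v : V, [set v] \in C -> tight_at (ht v)).

(** The last condition puts into [A] every filling that [tight_at] provides above the level of a
    vertex of [A]. *)
Definition admissible A := [/\ A \subset C,
  forall s t, s \in A -> t != set0 -> t \subset s -> t \in A &
  forall v : V, [set v] \in A -> above (ht v) \subset A].

Section Step.
Variables (A : {set {set V}}) (v : V).
Hypotheses (A_adm : admissible A) (vA : [set v] \in A)
  (vmin : forall u : V, [set u] \in A -> ht v <= ht u).

Let AC : A \subset C. Proof. by case: A_adm. Qed.
Let A_down s t : s \in A -> t != set0 -> t \subset s -> t \in A.
Proof. by case: A_adm => _ h _; apply: h. Qed.
Definition link := [set s : {set V} | (v \notin s) && (v |: s \in A)].

Lemma U1_neq0 s : v |: s != set0.
Proof. by apply/set0Pn; exists v; rewrite setU11. Qed.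

(** [v] is a lowest vertex of [A], and general position excludes a second vertex of the same
    height. *)
Lemma link_above s : s \in link -> s != set0 -> s \in above (ht v).
Proof.
rewrite inE => /andP[vs vsA] s0.
have sA : s \in A by apply: A_down vsA s0 _; apply: subsetUr.
rewrite inE (subsetP AC) //=; apply/forall_inP => u us.
have uA : [set u] \in A.
  by apply: A_down sA _ _; rewrite ?sub1set //; apply/set0Pn; exists u; rewrite set11.
rewrite lt_neqAle vmin // andbT; apply: ht_inj; rewrite ?(subsetP AC) //.
by apply: contraNneq vs => ->.
Qed.

Lemma above_notin s : s \in above (ht v) -> v \notin s.
Proof.
rewrite inE => /andP[_ /forall_inP sv]; apply/negP => /sv.
by rewrite ltxx.
Qed.

(** Adding [v] raises the size of a face by one and is injective on the link, so the bounds on faces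
    and cofaces in [C] descend to the link. *)
Lemma link_is_reducible : reducible link.
Proof.
have inj1 s t : v \notin s -> v \notin t -> v |: s = v |: t -> s = t.
  by move=> vs vt e; rewrite -(setU1K vs) e setU1K.
apply: link_reducible.
- by rewrite inE inE setU0 vA.
- move=> s t; rewrite !inE => /andP[vs vsA] ts.
  rewrite (contra (subsetP ts v) vs) /=.
  by apply: A_down vsA (U1_neq0 t) _; apply: setUS.
- move=> s; rewrite inE => /andP[vs /(subsetP AC)/dimC].
  by rewrite cardsU1 vs.
- move=> e e2; case: (boolP (v \in e)) => ve.
    rewrite [cofaces _ _ _](_ : _ = set0) ?cards0 //; apply/setP => s.
    rewrite !inE; apply/negP => /and3P[/andP[vs _] _ /subsetP/(_ v ve)].
    exact/negP.
  rewrite -(card_in_imset (f := fun s => v |: s)); last first.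
    by move=> s t; rewrite !inE => /andP[/andP[vs _] _] /andP[/andP[vt _] _]; apply: inj1.
  apply: leq_trans (pseudo (t := v |: e) _); last by rewrite cardsU1 ve e2.
  apply: subset_leq_card; apply/subsetP => _ /imsetP[s + ->].
  rewrite !inE => /and3P[/andP[vs vsA] /eqP s3 es].
  by rewrite (subsetP AC) //= cardsU1 vs s3 setUS.
Qed.

(** All removed faces contain [v], which lies above no vertex of [A]. *)
Lemma remove_admissible s A' : s \in link -> A' \subset A ->
  (forall r, (r \in A') = (r \in A) && ~~ (v |: s \subset r)) -> admissible A'.
Proof.
move=> sL sub A'E; split.
- exact: subset_trans AC.
- move=> r q; rewrite !A'E => /andP[rA nr] q0 qr.
  by rewrite (A_down rA) //=; apply: contra nr => /subset_trans; apply.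
- move=> u; rewrite A'E => /andP[uA _]; apply/subsetP => r ru; rewrite A'E.
  have [_ _ /(_ u uA)/subsetP-> //=] := A_adm.
  apply/negP => /subsetP/(_ v (setU11 _ _)) vr; move: ru.
  rewrite inE => /andP[_ /forall_inP/(_ v vr)].
  by rewrite ltNge vmin.
Qed.

(** Adding [v] turns a free pair of the link into a free pair of [A], and a critical cell into a
    maximal face that ends a cycle. What is removed receives the top value when it is put back. *)
Lemma peel : exists A', [/\ A' \proper A, admissible A' &
  (exists f, perfect_order A' f) -> exists f, perfect_order A f].
Proof.
have linkD (r : {set V}) : r \in A -> v \in r -> r :\ v \in link.
  by move=> rA vr; rewrite inE setD11 setD1K.
have sub_link (s r : {set V}) : s \in link -> (v |: s \subset r) = (v \in r) && (s \subset r :\ v).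
  move=> /[!inE]/andP[vs _]; rewrite subUset sub1set subsetD1 vs andbT.
  by [].
have [[s [t [sL tL st cst smax]]]|[s [z [sL zs smax zL dz]]]] := link_is_reducible.
  have [vs vsA] : v \notin s /\ v |: s \in A by move: sL; rewrite inE => /andP.
  have [vt vtA] : v \notin t /\ v |: t \in A by move: tL; rewrite inE => /andP.
  pose A' := [set r : {set V} in A | ~~ (v |: s \subset r)].
  have A'E (r : {set V}) : (r \in A') = (r \in A) && ~~ (v |: s \subset r) by rewrite inE.
  have A'A : A' \subset A by apply/subsetP => r; rewrite A'E => /andP[].
  have nsA' : v |: s \notin A' by rewrite A'E subxx andbF.
  have ntA' : v |: t \notin A' by rewrite A'E setUS ?andbF.
  exists A'; split; last 1 first.
  - case=> f gf; have -> : A = (v |: s) |: ((v |: t) |: A').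
      apply/setP => r; rewrite !in_setU1 A'E; apply/idP/or3P; last first.
        by case=> [/eqP->|/eqP->|/andP[]].
      move=> rA; case: (boolP (v |: s \subset r)) => sr; last by constructor 3; rewrite rA.
      move: sr; rewrite (sub_link s r sL) => /andP[vr sr].
      have [e|e] := smax _ (linkD r rA vr) sr; [constructor 1|constructor 2].
        by rewrite -e setD1K.
      by rewrite -e setD1K.
    apply: (perfect_order_pair gf) => //; first exact: setUS.
      by rewrite !cardsU1 vs vt cst.
    by move=> u; rewrite A'E => /andP[].
  - by rewrite properE A'A; apply/subsetPn; exists (v |: s).
  - exact: remove_admissible A'E.
have [vs vsA] : v \notin s /\ v |: s \in A by move: sL; rewrite inE => /andP.
pose A' := A :\ (v |: s).
have A'E (r : {set V}) : (r \in A') = (r \in A) && ~~ (v |: s \subset r).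
  rewrite in_setD1 andbC; case: (boolP (r \in A)) => //= rA; congr (~~ _).
  apply/eqP/idP => [->//|]; rewrite (sub_link s r sL) => /andP[vr sr].
  by rewrite -(smax _ (linkD r rA vr) sr) setD1K.
have A'A : A' \subset A by apply: subsetDl.
exists A'; split.
- exact: properD1.
- exact: remove_admissible A'E.
case=> f gf; rewrite -(setD1K vsA).
have [y [ys yA dy]] : exists y : {set V} -> 'F_2, [/\ y (v |: s) = 1,
    forall t, y t != 0 -> t \in A /\ #|t| = #|v |: s| &
    forall t, t != set0 -> bd y t = 0].
  (* If [s] is empty, [v |: s] is the single vertex [v], a cycle by itself; [tight_at] speaks of
     chains [z] of nonempty faces. *)
  have [s0|s0] := eqVneq s set0.
    exists (fun t => (t == v |: s)%:R); split=> [|t /F2_bool/eqP->//|t t0].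
      by rewrite eqxx.
    apply: (@bd_support_card _ 0); last by rewrite cards_eq0.
    by move=> u /F2_bool/eqP->; rewrite s0 setU0 cards1.
  have zv t : v \in t -> z t = 0.
    move=> vt; apply/eqP; apply: contraTT vt => /zL[].
    by rewrite inE => /andP[].
  have cs : #|s| = #|s|.-1.+1 by rewrite prednK // card_gt0.
  have cA t : cone v z t != 0 -> t \in A /\ #|t| = #|s|.+1.
    rewrite /cone; case: ifP => [vt /zL[]|]; last by rewrite eqxx.
    by rewrite inE setD1K // => /andP[_ tA] <-; rewrite (cardsD1 v) vt.
  have dc t : bd (cone v z) t = z t.
    by rewrite bd_cone // /cone dz if_same addr0.
  have [w' [w'L dw']] : exists w', (forall t, w' t != 0 ->
      t \in above (ht v) /\ #|t| = #|s|.-1.+2) /\ forall t, bd w' t = z t.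
    apply: (tight_ht (v := v) _ (w := cone v z)) dc.
    - exact: (subsetP AC).
    - move=> t zt; have [tL ts] := zL t zt; rewrite -cs; split=> //.
      apply: link_above => //; rewrite -cards_eq0 ts cards_eq0; exact: s0.
    - by move=> t /cA[/(subsetP AC) -> ->]; rewrite -cs.
  exists (fun t => cone v z t + w' t); split.
  - rewrite /cone setU11 setU1K // zs (_ : w' _ = 0) ?addr0 //.
    by apply/eqP; apply/negPn/negP => /w'L[/above_notin]; rewrite setU11.
  - move=> t; have [->|ct _] := eqVneq (cone v z t) 0.
      rewrite add0r => /w'L[tv ->]; rewrite cardsU1 vs -cs; split=> //.
      by have [_ _ /(_ v vA)/subsetP] := A_adm; apply.
    by have [tA ->] := cA t ct; rewrite cardsU1 vs.
  - by move=> t _; rewrite bdD dc dw' addF2.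
apply: (perfect_order_critical gf (z := y)) => //.
- by rewrite setD11.
- by move=> t; rewrite A'E => /andP[].
- by move=> t /yA[tA ct]; rewrite setD1K.
Qed.

End Step.

Lemma admissible_perfect_order A : admissible A -> exists f, perfect_order A f.
Proof.
have [n] := ubnP #|A|; elim: n A => // n IH A An adm.
have [->|/set0Pn[s sA]] := eqVneq A set0.
  by exists (fun=> 0%N); split=> [s t|s t|s]; rewrite inE.
have [AC down _] := adm.
have [u us] : exists u : V, u \in s.
  apply/set0Pn; apply: contraTneq sA => ->.
  by apply/negP => /(subsetP AC); case: C_complex => /negPf->.
have uA : [set u] \in A.
  by apply: down sA _ _; rewrite ?sub1set //; apply/set0Pn; exists u; rewrite set11.
case: (arg_minP (P := fun u : V => [set u] \in A) ht uA) => v vA vmin.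
have [A' [pA' adm' gA']] := peel adm vA vmin; apply: gA'; apply: IH adm'.
exact: leq_trans (proper_card pA') An.
Qed.

Lemma tight_perfect :
  exists f : {set V} -> int, discrete_morse C f /\ perfect C f.
Proof.
have [|f gf] := @admissible_perfect_order C.
  split=> //; first by case: C_complex.
  by move=> v _; apply/subsetP => s; rewrite inE => /andP[].
by exists (fun s => (f s)%:Z); apply: perfect_order_perfect.
Qed.

End TightComplex.

Local Open Scope classical_set_scope.
Local Open Scope ring_scope.

(** * The Borsuk-Ulam theorem *)

Section Antipodal.
Variables (E : eqType) (opp : E -> E) (b : seq E -> E) (N : nat).
Hypotheses (oppK : involutive opp) (b_opp : forall s, b (map opp s) = opp (b s)).
Implicit Types (s t m : seq E) (F G : seq E -> 'F_2) (w : nat -> E -> 'F_2).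

Definition cup (u : E -> 'F_2) G s : 'F_2 := if s is x :: _ then u x * G s else 0.

(* the cup product of the coboundaries of [w 0], ..., [w (k - 1)] *)
Fixpoint theta w k : seq E -> 'F_2 :=
  if k is k'.+1 then cobd (cup (w k') (theta w k')) else fun=> 1.

Lemma theta_cocycle w k s : size s = k.+2 -> cobd (theta w k) s = 0.
Proof.
case: k => [|k] sz; last exact: cobd_cobd.
by case: s sz => [|x [|y []]] //= _; rewrite /cobd /= !big_cons big_nil addr0 addF2.
Qed.

(** The coboundary of [w j] is one of the factors of [theta w k], and it vanishes where [w j] is
    constant. *)
Lemma theta_const w k j s : (j < k)%N -> size s = k.+1 ->
  (forall x y, x \in s -> y \in s -> w j x = w j y) -> theta w k s = 0.
Proof.
elim: k s => // k IH s; rewrite ltnS leq_eqVlt => /orP[/eqP->|jk] sz cst.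
  have [x xs] : exists x, x \in s by case: s sz {cst} => // x s; exists x; rewrite mem_head.
  rewrite /= /cobd big_seq (eq_bigr (fun t => w k x * theta w k t)).
    by rewrite -big_seq -mulr_sumr -/(cobd _ s) theta_cocycle ?mulr0.
  move=> t ts; have := size_facets ts; have := mem_facets ts.
  case: t ts => [|y t] ts sub; first by rewrite sz.
  by move=> _; rewrite /cup (cst y x) // sub ?mem_head.
rewrite /= /cobd big_seq big1 // => t ts.
case: t ts => // y t ts; rewrite /cup IH ?mulr0 //.
  by have := size_facets ts; rewrite sz => -[->].
by move=> u v ut vt; apply: cst; apply: mem_facets; eassumption.
Qed.

Definition antisymmetric_on w k s :=
  forall j x, (j < k)%N -> x \in s -> w j (opp x) = 1 + w j x.

(** Adding the constant 1 to [w j] does not change its coboundary. *)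
Lemma theta_opp w k s : size s = k.+1 -> antisymmetric_on w k s ->
  theta w k (map opp s) = theta w k s.
Proof.
elim: k s => // k IH s sz ws; rewrite /= cobd_map.
rewrite -[RHS]addr0 -(theta_cocycle w sz) /cobd -big_split.
apply: eq_big_seq => t ts /=.
have szt : size t = k.+1 by have := size_facets ts; rewrite sz => -[->].
have {}IH : theta w k (map opp t) = theta w k t.
  by apply: IH => // j x jk xt; apply: ws (ltnW jk) _; apply: mem_facets xt.
case: t ts szt IH => //= x t ts szt ->; rewrite ws ?(mem_facets ts) ?mem_head //.
by rewrite mulrDl mul1r addrC.
Qed.

Variable apex : nat -> E.

(** The [k]-simplices with vertex [apex k] in the boundary of the cross-polytope on [apex 0], ...,
    [apex k] and their opposites. *)
Fixpoint hemi k : seq (seq E) :=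
  if k is k'.+1 then [seq apex k :: t | t <- hemi k' ++ map (map opp) (hemi k')]
  else [:: [:: apex 0]].

Definition sphere k := hemi k ++ map (map opp) (hemi k).

Lemma hemiS k : hemi k.+1 = [seq apex k.+1 :: t | t <- sphere k].
Proof. by []. Qed.

Lemma size_hemi k s : s \in hemi k -> size s = k.+1.
Proof.
elim: k s => [|k IH] s; first by rewrite inE => /eqP->.
rewrite hemiS => /mapP[t]; rewrite mem_cat => /orP[/IH tk|/mapP[u /IH uk ->]] -> /=.
  by rewrite tk.
by rewrite size_map uk.
Qed.

Lemma sphere_sym F k : \sum_(s <- sphere k) F (map opp s) = \sum_(s <- sphere k) F s.
Proof.
rewrite /sphere !big_cat /= !big_map addrC; congr (_ + _).
by apply: eq_bigr => s _; rewrite -map_comp (eq_map (g := id)) ?map_id.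
Qed.

(** A cone over a cycle has that cycle as its boundary, and [sphere k] is a cycle: its two
    hemispheres have the same boundary. *)
Lemma hemi_boundary F k :
  \sum_(s <- hemi k.+1) cobd F s = \sum_(s <- sphere k) F s.
Proof.
have hS G j : \sum_(s <- hemi j.+1) cobd G s = \sum_(s <- sphere j) G s +
    \sum_(s <- sphere j) cobd (fun t => G (apex j.+1 :: t)) s.
  by rewrite hemiS big_map -big_split; apply: eq_bigr => s _; rewrite cobd_cons.
rewrite hS -[RHS]addr0; congr (_ + _); move: (fun t => F (apex k.+1 :: t)) => {}F.
elim: k F => [|k IH] F.
  by rewrite /sphere /= !big_cons big_nil /cobd /= !big_cons !big_nil !addr0 addF2.
have hb G : \sum_(s <- hemi k.+1) cobd G s = \sum_(s <- sphere k) G s.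
  by rewrite hS IH addr0.
rewrite {1}/sphere big_cat big_map /= hb.
by under eq_bigr do rewrite cobd_map; rewrite hb sphere_sym addF2.
Qed.

Variables (w : nat -> E -> 'F_2) (n : nat).
Hypothesis w_anti : forall k s m, (k <= n)%N -> s \in hemi k -> m \in sds b N s ->
  antisymmetric_on w n m.

(* [theta w k] is [B + B \o opp] for [B = cup (w k) (theta w k)], so its value on a
   hemisphere is that of [B] on a sphere, the boundary of the next hemisphere. *)
Lemma theta_hemi k : (k <= n)%N ->
  \sum_(s <- hemi k) \sum_(m <- sds b N s) theta w k m = 1.
Proof.
elim: k => [_|k IH kn].
  rewrite big_seq1; elim: N [:: apex 0] (erefl : size [:: apex 0] = 1%N) => [|M IH] s sz.
    by rewrite big_seq1.
  rewrite big_sds; case: s sz => [|x []] // _.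
  by rewrite /sd /= big_seq1 IH.
rewrite -[RHS](IH (ltnW kn)) /=.
under eq_bigr do rewrite cobd_sds.
rewrite hemi_boundary /sphere big_cat big_map /= -big_split.
apply: eq_big_seq => s sk /=.
rewrite (sds_map b_opp) big_map -big_split; apply: eq_big_seq => m ms /=.
have ma := w_anti (ltnW kn) sk ms.
have szm : size m = k.+1 by rewrite (size_sds ms) (size_hemi sk).
have := theta_opp szm (fun j x jk => ma j x (ltn_trans jk kn)).
case: m ms ma szm => // x m ms ma szm e.
rewrite [cup _ _ (map _ _)]/= -[opp x :: _]/(map opp (x :: m)) e ma ?mem_head //.
by rewrite [cup _ _ _]/= mulrDl mul1r addrCA addF2 addr0.
Qed.

(** [theta w n] has total 1 on the subdivided hemisphere, so it is nonzero on some small simplex;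
    there no [w j] is constant. *)
Lemma antipodal_simplex : exists s m, [/\ s \in hemi n, m \in sds b N s &
  forall j, (j < n)%N -> exists x y, [/\ x \in m, y \in m & w j x != w j y]].
Proof.
have : \sum_(s <- hemi n) \sum_(m <- sds b N s) theta w n m != 0.
  by rewrite theta_hemi.
move=> sum0; have [s sn] : exists2 s, s \in hemi n &
    \sum_(m <- sds b N s) theta w n m != 0.
  apply/hasP; apply: contraNT sum0 => /hasPn h.
  by rewrite big_seq big1 // => s /h; rewrite negbK => /eqP.
move=> {}sum0; have [m ms m0] : exists2 m, m \in sds b N s & theta w n m != 0.
  apply/hasP; apply: contraNT sum0 => /hasPn h.
  by rewrite big_seq big1 // => m /h; rewrite negbK => /eqP.
exists s, m; split=> // j jn; have szm : size m = n.+1.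
  by rewrite (size_sds ms) (size_hemi sn).
suff /hasP[x xm /hasP[y ym xy]] : has (fun x => has (fun y => w j x != w j y) m) m.
  by exists x, y.
apply: contraNT m0 => /hasPn h; apply/eqP; apply: (theta_const jn szm) => x y xm ym.
by apply/eqP; have /hasPn/(_ y ym) := h x xm; rewrite negbK.
Qed.

End Antipodal.

(** A Lebesgue number for any property inherited by subsets; it serves for the signs in the
    Borsuk-Ulam theorem and for the labels of singular simplices. *)
Lemma lebesgue_number (R : realType) (T : pseudoMetricType R) (K : set T)
    (fine : set T -> Prop) : compact K ->
  (forall A B, A `<=` B -> fine B -> fine A) ->
  (forall x, K x -> exists2 r, 0 < r & fine (ball x r `&` K)) ->
  exists2 d, 0 < d & forall x, K x -> fine (ball x d `&` K).
Proof.
move=> /compact_near_coveringP cK fineW loc.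
have [] := cK R (0^'+) (fun d x => fine (ball x d `&` K)).
  move=> x Kx; have [r r0 fr] := loc x Kx; have r20 : 0 < r / 2 by rewrite divr_gt0.
  exists (ball x (r / 2), [set d | 0 < d < r / 2]); first split => /=.
  - exact: nbhsx_ballx.
  - near=> d; rewrite /=; apply/andP; split; near: d.
      exact: nbhs_right_gt.
    exact: nbhs_right_lt.
  - case=> y d /= [xy /andP[d0 dr]]; apply: fineW fr => z [yz Kz]; split=> //.
    have := ball_triangle xy yz; apply: le_ball.
    by rewrite [leRHS](splitr r) lerD2l ltW.
move=> e /= e0 he; exists (e / 2); first by rewrite divr_gt0.
move=> x Kx; apply: he Kx => /=; last by rewrite divr_gt0.
by rewrite sub0r normrN gtr0_norm ?divr_gt0 // gtr_pMr // invf_lt1 // ltr1n.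
Unshelve. all: by end_near. Qed.

Lemma sds_mesh_seq (R : realType) (n : nat) (ss : seq (seq 'rV[R]_n)) (d : R) :
  0 < d -> exists N0, forall N, (N0 <= N)%N -> forall s, s \in ss ->
  forall m, m \in sds (@bary R n) N s ->
  forall x y, x \in m -> y \in m -> `|x - y| < d.
Proof.
move=> d0; elim: ss => [|s ss [N1 h1]]; first by exists 0%N.
have [N2 h2] := sds_mesh s d0; exists (maxn N1 N2) => N.
rewrite geq_max => /andP[l1 l2] t; rewrite inE => /orP[/eqP->|ts].
  exact: h2.
exact: h1.
Qed.

Lemma mx_entry_le_norm (R : realType) (m n : nat) (A : 'M[R]_(m, n)) i j :
  `|A i j| <= `|A|.
Proof. by rewrite [leRHS]mx_normrE; apply: (le_bigmax _ _ (i, j)). Qed.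

Lemma mx_norm_le (R : realType) (m n : nat) (A : 'M[R]_(m, n)) (c : R) :
  0 <= c -> (forall i j, `|A i j| <= c) -> `|A| <= c.
Proof. by move=> c0 Ac; rewrite [leLHS]mx_normrE; apply: bigmax_le. Qed.

Section BorsukUlam.
Variables (R : realType) (n : nat).
Implicit Types (x y : 'rV[R]_n.+1).

(** The norm is the maximum norm, in which the boundary of the cross-polytope lies between these
    radii; maps live on this shell so that its points need not be normalized. *)
Definition annulus : set 'rV[R]_n.+1 := [set x | n.+1%:R^-1 <= `|x| <= 1].

Lemma annulus_compact : compact annulus.
Proof.
apply: bounded_closed_compact.
  exists 1; split=> [|M M1 x /andP[_ x1]]; first exact: num_real.
  exact: le_trans x1 (ltW M1).
have -> : annulus = (fun x => `|x|) @^-1` `[n.+1%:R^-1, 1].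
  by apply/seteqP; split => x /=; rewrite in_itv.
apply: preimage_closed; last exact: interval_closed.
by move=> x _; apply: norm_continuous.
Qed.

Let apex i : 'rV[R]_n.+1 := delta_mx 0 (inord i).

(** On each simplex some linear functional with coefficients bounded by 1 equals 1, which bounds the
    maximum norm below by 1/(n+1). *)
Lemma hemi_annulus N k s m x : (k <= n)%N -> s \in hemi -%R apex k ->
  m \in sds (@bary R n.+1) N s -> x \in m -> annulus x.
Proof.
move=> kn sk ms xm.
have [c [c1 cs]] : exists c : 'cV[R]_n.+1, (forall i, `|c i 0| <= 1) /\
    forall y, y \in s -> y *m c = 1%:M /\
      exists2 j, (j <= k)%N & y = apex j \/ y = - apex j.
  have ac j (c : 'cV[R]_n.+1) : apex j *m c = (c (inord j) 0)%:M.
    by rewrite -rowE; apply/rowP => i; rewrite !mxE ord1 eqxx mulr1n.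
  elim: k s kn sk {ms xm} => [|k IH] s kn.
    rewrite inE => /eqP->; exists (const_mx 1); split=> [i|y].
      by rewrite mxE normr1.
    by rewrite inE => /eqP->; rewrite ac mxE; split=> //; exists 0%N => //; left.
  rewrite hemiS => /mapP[t ts ->].
  have [c [c1 ct]] : exists c : 'cV[R]_n.+1, (forall i, `|c i 0| <= 1) /\
      forall y, y \in t -> y *m c = 1%:M /\
        exists2 j, (j <= k)%N & y = apex j \/ y = - apex j.
    move: ts; rewrite mem_cat => /orP[/IH|/mapP[u /IH hu ->]]; first by apply; apply: ltnW.
    have [c [c1 cu]] := hu (ltnW kn); exists (- c); split=> [i|_ /mapP[y yu ->]].
      by rewrite mxE normrN.
    have [yc [j jk yj]] := cu y yu; rewrite mulNmx mulmxN opprK; split=> //.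
    by exists j => //; case: yj => ->; [right|left; rewrite opprK].
  exists (\col_i if i == inord k.+1 then 1 else c i 0); split=> [i|y].
    by rewrite mxE; case: ifP; rewrite ?normr1.
  rewrite inE => /orP[/eqP->|yt].
    rewrite ac mxE eqxx; split=> //; exists k.+1 => //; by left.
  have [yc [j jk yj]] := ct y yt; split; last by exists j => //; apply: leqW.
  have jn : (inord j == inord k.+1 :> 'I_n.+1) = false.
    by apply/eqP => /(congr1 val) /=; rewrite !inordK ?ltnS //; lia.
  by case: yj yc => ->; rewrite ?mulNmx !ac mxE jn.
have xc : x *m c = 1%:M.
  apply: (sds_closed (@bary_mulmx_eq R _ _ c 1%:M) _ ms xm).
  by move=> y /cs[].
have x1 : `|0 - x| <= 1.
  apply: (sds_closed (@bary_ball R n.+1 0 1) _ ms xm).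
  move=> y /cs[_ [j _ yj]].
  have a1 : `|apex j| <= 1.
    apply: mx_norm_le => // i l.
    by rewrite mxE; case: (_ && _); rewrite ?normr1 ?normr0 ?ler01.
  by case: yj => ->; rewrite sub0r ?opprK ?normrN.
rewrite sub0r normrN in x1; rewrite /annulus /= x1 andbT.
rewrite -div1r ler_pdivrMr ?ltr0Sn //.
have e : \sum_j x 0 j * c j 0 = 1.
  by have := congr1 (fun M : 'M[R]_1 => M 0 0) xc; rewrite !mxE eqxx.
rewrite -[leLHS]e.
apply: le_trans (ler_norm _) _; apply: le_trans (ler_norm_sum _ _ _) _.
rewrite mulr_natr -[X in _ *+ X](card_ord n.+1) -sumr_const.
apply: ler_sum => i _; rewrite normrM -[leRHS]mulr1 ler_pM //.
exact: mx_entry_le_norm.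
Qed.

(** If [F] had no zero, some coordinate would keep its sign near each point. On a fine subdivision
    this contradicts [antipodal_simplex], applied to the signs of the coordinates. *)
Lemma borsuk_ulam (F : 'rV[R]_n.+1 -> 'rV[R]_n) :
  (forall x, annulus x -> F y @[y --> within annulus (nbhs x)] --> F x) ->
  (forall x, annulus x -> F (- x) = - F x) ->
  exists2 x, annulus x & F x = 0.
Proof.
move=> Fc Fodd; apply: contrapT => nF.
have F0 x : annulus x -> F x != 0 by move=> ax; apply/eqP => Fx; apply: nF; exists x.
(* The choice made by [pick] depends only on which coordinates vanish, so it is the same for [x] and
   [- x]. *)
pose sgn (x : 'rV[R]_n.+1) : bool :=
  if [pick i | x 0 i != 0] is Some i then 0 < x 0 i else false.
have sgnN x : annulus x -> sgn (- x) = ~~ sgn x.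
  move=> /andP[x0 _]; rewrite /sgn.
  rewrite (eq_pick (Q := fun i => x 0 i != 0)); last by move=> i; rewrite /= mxE oppr_eq0.
  case: pickP => [i xi|xi]; first by rewrite mxE oppr_gt0 -leNgt lt_neqAle xi.
  suff : `|x| <= 0 by move/(le_trans x0); rewrite leNgt invr_gt0 ltr0Sn.
  apply: mx_norm_le => // i j; rewrite ord1.
  by move/negbFE/eqP: (xi j) => ->; rewrite normr0.
(* [sgn] is an odd tie-break where coordinate [j] of [F] vanishes *)
pose w (j : nat) (x : 'rV[R]_n.+1) : 'F_2 :=
  if insub j is Some i then (if F x 0 i == 0 then sgn x else 0 < F x 0 i)%:R else 0.
have w_anti j x : (j < n)%N -> annulus x -> w j (- x) = 1 + w j x.
  move=> jn ax; rewrite /w insubT Fodd // mxE oppr_eq0.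
  have b1 (c : bool) : ((~~ c)%:R : 'F_2) = 1 + c%:R by case: c; rewrite ?addF2 ?addr0.
  case: (altP eqP) => Fx; first by rewrite sgnN.
  by rewrite oppr_gt0 ltNge le_eqVlt eq_sym (negPf Fx) /= b1.
pose fine (S : set 'rV[R]_n.+1) := exists2 j, (j < n)%N &
  forall x y, S x -> S y -> w j x = w j y.
have [|x ax|d d0 hd] := lebesgue_number annulus_compact (fine := fine).
- by move=> A B AB [j jn Bj]; exists j => // x y /AB Bx /AB; apply: Bj.
- have /rV0Pn[i Fi] := F0 x ax.
  have Fi0 : 0 < `|F x 0 i| by rewrite normr_gt0.
  have /cvgrPdist_lt/(_ _ Fi0)/nbhs_ballP[r r0 hr] := Fc x ax.
  exists r => //; exists (val i); first exact: ltn_ord.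
  move=> y z [xy ay] [xz az].
  have sign y' : ball x r y' -> annulus y' -> w i y' = (0 < F x 0 i)%R%:R.
    move=> xy' ay'; rewrite /w valK.
    have : `|F x 0 i - F y' 0 i| < `|F x 0 i|.
      apply: le_lt_trans (hr y' xy' ay').
      by have := mx_entry_le_norm (F x - F y') 0 i; rewrite !mxE.
    have [->|Fy0] := eqVneq (F y' 0 i) 0; first by rewrite subr0 ltxx.
    case: (ltrgt0P (F x 0 i)) Fi => // Fx _; case: (ltrgt0P (F y' 0 i)) Fy0 => // Fy _.
      by rewrite ltr_norml => /andP[_ h]; exfalso; lra.
    by rewrite ltr_norml => /andP[h _]; exfalso; lra.
  by rewrite !sign.
have [N hN] := sds_mesh_seq (hemi -%R apex n) d0.
have [||k s m kn sn ms|s [m [sn ms hm]]] :=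
  @antipodal_simplex _ -%R (@bary R n.+1) N _ _ apex w n.
- exact: opprK.
- exact: bary_opp.
- move=> j x jn xm; apply: w_anti jn _; exact: hemi_annulus kn sn ms xm.
have [x xm] : exists x, x \in m.
  have := size_hemi sn; rewrite -(size_sds ms).
  by case: m {ms hm} => // x m; exists x; rewrite mem_head.
have mA y : y \in m -> annulus y by apply: hemi_annulus sn ms.
have [j jn hj] := hd x (mA x xm).
have [y [z [ym zm /eqP]]] := hm j jn; apply.
have near u : u \in m -> (ball x d `&` annulus) u.
  move=> um; split; last exact: mA.
  by rewrite mx_norm_ball /ball_ /=; apply: (hN N _ _ _ _ ms).
by apply: hj; apply: near.
Qed.

End BorsukUlam.

(** * Faces of a triangulated 3-manifold *)

Lemma continuous_add (R : realType) (T : topologicalType) (f g : T -> R) :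
  continuous f -> continuous g -> continuous (fun x => f x + g x).
Proof. by move=> cf cg x; apply: cvgD; [exact: cf|exact: cg]. Qed.

Lemma continuous_opp (R : realType) (T : topologicalType) (f : T -> R) :
  continuous f -> continuous (fun x => - f x).
Proof. by move=> cf x; apply: cvgN; exact: cf. Qed.

Lemma continuous_maxf (R : realType) (T : topologicalType) (f g : T -> R) :
  continuous f -> continuous g -> continuous (fun x => Num.max (f x) (g x)).
Proof. by move=> cf cg x; apply: continuous_max; [exact: cf|exact: cg]. Qed.

Lemma continuous_minf (R : realType) (T : topologicalType) (f g : T -> R) :
  continuous f -> continuous g -> continuous (fun x => Num.min (f x) (g x)).
Proof. by move=> cf cg x; apply: continuous_min; [exact: cf|exact: cg]. Qed.

Lemma continuous_lincomb (R : realType) (T : topologicalType) (I : finType) (m : nat)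
    (c : T -> I -> R) (u : I -> 'rV[R]_m) :
  (forall i, continuous (c^~ i)) -> continuous (fun q => \sum_i c q i *: u i).
Proof.
move=> cc; apply: continuous_big; first exact: add_continuous.
by move=> i _ q; apply: cvgZ; [exact: cc|exact: cvg_cst].
Qed.

(* the legs of the tripod, as functions of a point of the plane with coordinates
   [(a, b, 0)] modulo [(1, 1, 1)]: leg [i] is active where coordinate [i] is the
   strict maximum, and antipodal points never have the same image *)
Definition leg (R : realType) (a b : R) (i : nat) : R :=
  Num.max 0 (nth 0 [:: Num.min (a - b) a; Num.min (b - a) b; Num.min (- a) (- b)] i).

Lemma max0_minP (R : realType) (x y : R) :
  (Num.max 0 (Num.min x y) = 0 /\ (x <= 0 \/ y <= 0)) \/
  [/\ 0 < Num.max 0 (Num.min x y), 0 < x & 0 < y].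
Proof.
rewrite lt_max ltxx lt_min /=; case: (boolP (0 < x)) => [x0|]; last first.
  by rewrite -leNgt => x0; left; split; [apply/max_idPl; rewrite ge_min x0|left].
case: (boolP (0 < y)) => [y0|]; first by right.
by rewrite -leNgt => y0; left; split; [apply/max_idPl; rewrite ge_min y0 orbT|right].
Qed.

Lemma leg_bounds (R : realType) (a b r : R) (i : nat) : `|a| <= r -> `|b| <= r ->
  0 <= leg a b i <= 2 * r.
Proof.
rewrite !ler_norml => /andP[a1 a2] /andP[b1 b2].
rewrite /leg le_max lexx ge_max /= mulr_ge0 //=; last by lra.
by case: i => [|[|[|i]]] /=; rewrite ?nth_nil ?ge_min ?mulr_ge0 //; try (apply/orP; left); lra.
Qed.

(** At most one coordinate is the strict maximum; this will keep the weights given by the legs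
    within one of three tetrahedra. *)
Lemma leg_exclusive (R : realType) (a b : R) :
  (leg a b 1 != 0 -> leg a b 0 = 0 /\ leg a b 2 = 0) /\
  (leg a b 2 != 0 -> leg a b 0 = 0 /\ leg a b 1 = 0).
Proof.
rewrite /leg /=; split=> /eqP n0.
  have [[//]|[_ ? ?]] := max0_minP (b - a) b.
  by have [[-> _]|[_ ? ?]] := max0_minP (a - b) a; [|exfalso; lra];
     have [[-> _]|[_ ? ?]] := max0_minP (- a) (- b); [|exfalso; lra].
have [[//]|[_ ? ?]] := max0_minP (- a) (- b).
by have [[-> _]|[_ ? ?]] := max0_minP (a - b) a; [|exfalso; lra];
   have [[-> _]|[_ ? ?]] := max0_minP (b - a) b; [|exfalso; lra].
Qed.

(** A leg active at both points would make one coordinate a strict maximum and a strict minimum. So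
    no leg is active: maximum and minimum of (a, b, 0) are both attained twice, and the three
    numbers agree. *)
Lemma leg_antipodal (R : realType) (a b : R) :
  leg a b 0 = leg (- a) (- b) 0 -> leg a b 1 = leg (- a) (- b) 1 ->
  leg a b 2 = leg (- a) (- b) 2 -> a = 0 /\ b = 0.
Proof.
have opp_zero (x y x' y' : R) : x' = - x -> y' = - y ->
    Num.max 0 (Num.min x y) = Num.max 0 (Num.min x' y') ->
    (x <= 0 \/ y <= 0) /\ (0 <= x \/ 0 <= y).
  move=> -> -> e; have := max0_minP x y; have := max0_minP (- x) (- y); rewrite -e.
  by move=> [[-> [?|?]]|[? ? ?]] [[? [?|?]]|[? ? ?]]; split; by [left; lra|right; lra|lra].
rewrite /leg /= => /opp_zero-/(_ _ _)[||h1 h2]; [lra|lra|].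
move=> /opp_zero-/(_ _ _)[||h3 h4]; [lra|lra|].
move=> /opp_zero-/(_ _ _)[||h5 h6]; [lra|lra|].
by case: h1 => ?; case: h2 => ?; case: h3 => ?; case: h4 => ?; case: h5 => ?;
  case: h6 => ?; split; lra.
Qed.

Lemma barycentric_lincomb (R : realType) (V : finType) (C : {set {set V}}) (k n : nat)
    (p : V -> 'rV[R]_k) (c : 'I_n -> R) (f : 'I_n -> V) (s : {set V}) :
  (forall i, 0 <= c i) -> \sum_i c i = 1 -> s \in C -> (forall i, c i != 0 -> f i \in s) ->
  barycentric R C [ffun v => \sum_i c i * (v == f i)%:R] /\
  affine_ext p [ffun v => \sum_i c i * (v == f i)%:R] = \sum_i c i *: p (f i).
Proof.
move=> c0 c1 sC cs; split; first split=> [v|].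
- by rewrite ffunE sumr_ge0 // => i _; rewrite mulr_ge0.
- split; last first.
    exists s => // v vs; rewrite ffunE big1 // => i _.
    case: eqP => [vi|_]; last by rewrite mulr0.
    by rewrite mulr1; apply/eqP; apply: contraNT vs => /cs; rewrite vi.
  under eq_bigr do rewrite ffunE.
  rewrite exchange_big -[RHS]c1; apply: eq_bigr => i _ /=.
  by rewrite -mulr_sumr (bigD1 (f i)) //= eqxx big1 ?addr0 ?mulr1 // => v /negPf->.
rewrite /affine_ext; under eq_bigr do rewrite ffunE scaler_suml.
rewrite exchange_big; apply: eq_bigr => i _ /=.
rewrite (bigD1 (f i)) //= eqxx mulr1 big1 ?addr0 // => v /negPf->.
by rewrite mulr0 scale0r.
Qed.

Section Manifold.
Variables (R : realType) (V : finType) (C : {set {set V}}).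
Hypothesis C_manifold : triangulates_manifold R 3 C.

(** A chart enters through its continuity and its left inverse, its values being read as points of
    R^3. Since [t] is injective, the weights [c q] can be read off from the point [h q]. *)
Lemma manifold_no_double (k : nat) (t : 'I_k -> V) (c : 'rV[R]_4 -> 'I_k -> R) (rho : R) :
  injective t -> (forall i, continuous (c^~ i)) -> 0 < rho ->
  (forall q, `|q| <= rho -> [/\ forall i, 0 <= c q i, \sum_i c q i = 1 &
     exists2 s : {set V}, s \in C & forall i, c q i != 0 -> t i \in s]) ->
  (forall q, `|q| <= rho -> (forall i, c q i = c (- q) i) -> q = 0) -> False.
Proof.
move=> t_inj cc rho0 cC cN.
pose h q : 'rV[R]_#|V| := \sum_i c q i *: delta_mx 0 (enum_rank (t i)).
have hc : continuous h by apply: continuous_lincomb.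
have hE q i : h q 0 (enum_rank (t i)) = c q i.
  rewrite summxE (bigD1 i) //= !mxE !eqxx mulr1 big1 ?addr0 // => j ji.
  by rewrite !mxE eqxx (inj_eq enum_rank_inj) (inj_eq t_inj) eq_sym (negPf ji) mulr0.
have hX q : `|q| <= rho -> standard_polyhedron R C (h q).
  move=> /cC[c0 c1 [s sC cs]].
  have [wC we] := barycentric_lincomb (fun v => delta_mx 0 (enum_rank v)) c0 c1 sC cs.
  by exists [ffun v => \sum_i c q i * (v == t i)%:R].
have X0 : standard_polyhedron R C (h 0) by apply: hX; rewrite normr0 ltW.
have [U [W [oU Uh0 _ [f [g [fc [_ [fg _]]]]]]]] := C_manifold X0.
have /nbhs_ballP[r /= r0 hU] : nbhs (0 : 'rV[R]_4) (h @^-1` U).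
  by apply: hc; apply: open_nbhs_nbhs.
(* Scaled by [e], the shell stays where the weights are controlled and strictly inside a ball that
   [h] maps into the chart domain. *)
pose e := Num.min (r / 2) rho.
have e0 : 0 < e by rewrite lt_min rho0 divr_gt0.
have er : e < r by rewrite gt_min gtr_pMr // invf_lt1 // ltr1n.
have small a (x : 'rV[R]_4) : `|a| <= e -> annulus x -> `|a *: x| <= e.
  by move=> ae /andP[_ x1]; rewrite normrZ -[leRHS]mulr1 ler_pM.
have dom a (x : 'rV[R]_4) : `|a| <= e -> annulus x -> (standard_polyhedron R C `&` U) (h (a *: x)).
  move=> ae ax; have le := small a x ae ax; split.
    by apply: hX; apply: le_trans le _; rewrite ge_min lexx orbT.
  by apply: hU; rewrite mx_norm_ball /ball_ /= sub0r normrN; apply: le_lt_trans er.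
have fhc a (x : 'rV[R]_4) : `|a| <= e -> annulus x ->
    f (h (a *: y)) @[y --> within (@annulus R 3) (nbhs x)] --> f (h (a *: x)).
  move=> ae ax; have /subspace_continuousP/(_ _ (dom a x ae ax)) fx := fc.
  apply: cvg_trans fx => P /=; rewrite !nbhs_simpl /= => nP.
  have ha : {for x, continuous (fun y : 'rV[R]_4 => h (a *: y))}.
    apply: (@continuous_comp _ _ _ (fun y : 'rV[R]_4 => a *: y) h); last exact: hc.
    exact: scaler_continuous.
  have /= := ha _ nP; rewrite /within /= !nbhs_simpl /=.
  by apply: filterS => y hy ay; apply: hy; apply: dom.
have ee : `|e| <= e by rewrite gtr0_norm.
have eNe : `|- e| <= e by rewrite normrN gtr0_norm.
have [x ax|x ax|x ax] := @borsuk_ulam R 3 (fun x => f (h (e *: x)) - f (h (- e *: x))).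
- exact: cvgB (fhc e x ee ax) (fhc (- e) x eNe ax).
- by rewrite !scalerN !scaleNr opprK opprB.
move/eqP; rewrite subr_eq0 => /eqP fx.
have hx : h (e *: x) = h (- e *: x).
  have [[_ gx] [_ gx']] := (fg _ (dom e x ee ax), fg _ (dom (- e) x eNe ax)).
  by rewrite -gx fx gx'.
have /eqP : e *: x = 0.
  apply: cN; first by apply: le_trans (small e x ee ax) _; rewrite ge_min lexx orbT.
  by move=> i; rewrite -!hE hx scaleNr.
rewrite scaler_eq0 gt_eqF //= => /eqP x0.
by case/andP: ax; rewrite x0 normr0 leNgt invr_gt0 ltr0Sn.
Qed.

Let coord_cont (i : 'I_4) : continuous (fun q : 'rV[R]_4 => q 0 i).
Proof. exact: coord_continuous. Qed.

Lemma manifold_dim (s : {set V}) : s \in C -> (#|s| <= 4)%N.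
Proof.
move=> sC; rewrite leqNgt; apply/negP => s5.
have [v0 _] : exists v, v \in s by apply/card_gt0P; apply: ltn_trans s5.
pose t (i : 'I_5) := nth v0 (enum s) i.
have lt_i (i : 'I_5) : (i < size (enum s))%N by rewrite -cardE; apply: leq_trans s5.
(* The barycentre of five vertices, moved by [q] in four weights; the last weight keeps the total 1
   and stays nonnegative because 4/20 = 1/5. *)
pose c (q : 'rV[R]_4) (i : 'I_5) :=
  5%:R^-1 + (if unlift ord_max i is Some j then q 0 j else - \sum_j q 0 j).
have cb (q : 'rV[R]_4) i : `|q| <= 20%:R^-1 -> 0 <= c q i.
  move=> q1; have qj j : `|q 0 j| <= 20%:R^-1 by apply: le_trans (mx_entry_le_norm _ _ _) q1.
  rewrite /c; case: unliftP => [j|] _.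
    by have := qj j; rewrite ler_norml => /andP[]; lra.
  rewrite !big_ord_recl big_ord0.
  have := (qj ord0, qj (lift ord0 ord0), qj (lift ord0 (lift ord0 ord0)),
    qj (lift ord0 (lift ord0 (lift ord0 ord0)))).
  by rewrite !ler_norml => -[[[/andP[_ ?] /andP[_ ?]] /andP[_ ?]] /andP[_ ?]]; lra.
apply: (@manifold_no_double 5 t c 20%:R^-1).
- move=> i j /eqP; rewrite /t nth_uniq ?enum_uniq //.
  by move/eqP/val_inj.
- move=> i; rewrite /c; case: (unlift _ _) => [j|] q.
    by move: q; apply: continuous_add; [exact: cst_continuous|exact: coord_cont].
  move: q; apply: continuous_add; first exact: cst_continuous.
  apply: continuous_opp; apply: continuous_big; first exact: add_continuous.
  by move=> j _; apply: coord_cont.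
- by rewrite invr_gt0.
- move=> q q1; split=> [i||]; first exact: cb.
    rewrite (bigD1_ord ord_max) //= /c unlift_none.
    under eq_bigr do rewrite liftK.
    rewrite big_split /= sumr_const card_ord addrACA.
    by rewrite addNr addr0 -mulr_natr; lra.
  by exists s => // i _; rewrite /t -mem_enum mem_nth.
move=> q _ cq; apply/rowP => i; rewrite mxE.
have := cq (lift ord_max i); rewrite /c liftK mxE => e; lra.
Qed.

Lemma manifold_pseudo (t : {set V}) : #|t| = 3%N -> (#|cofaces C 3 t| <= 2)%N.
Proof.
move=> t3; rewrite leqNgt; apply/negP => /card_gt2P[s0 [s1 [s2 [[h0 h1 h2] [d01 d12 d20]]]]].
have ext s : s \in cofaces C 3 t -> s \in C /\ exists2 d, d \notin t & s = d |: t.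
  rewrite !inE => /and3P[sC /eqP s4 ts]; split=> //.
  have /eqP/cards1P[d sd] : #|s :\: t| = 1%N.
    by have := cardsID t s; rewrite (setIidPr ts) s4 t3; lia.
  have dt : d \notin t by move/setP/(_ d): sd; rewrite !inE eqxx; case/andP.
  exists d => //; apply/setP => w; rewrite !inE; move/setP/(_ w): sd; rewrite !inE => <-.
  by case: (boolP (w \in t)) => [/(subsetP ts)->|_]; rewrite ?orbT ?orbF.
have [C0 [d0 d0t e0]] := ext _ h0; have [C1 [d1 d1t e1]] := ext _ h1.
have [C2 [d2 d2t e2]] := ext _ h2; rewrite {ext h0 h1 h2}.
pose ts := enum t ++ [:: d0; d1; d2].
have szts : size ts = 6 by rewrite size_cat -cardE t3.
have uts : uniq ts.
  rewrite cat_uniq enum_uniq /= !mem_enum (negPf d0t) (negPf d1t) (negPf d2t) /= !inE.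
  rewrite negb_or andbT -andbA; apply/and3P; split.
  - by apply: contraNneq d01 => d; rewrite e0 e1 d.
  - by apply: contraNneq d20 => d; rewrite e0 e2 d.
  - by apply: contraNneq d12 => d; rewrite e1 e2 d.
pose o j : 'I_4 := inord j.
pose lg (q : 'rV[R]_4) := leg (q 0 (o 0)) (q 0 (o 1)).
(* Around the barycentre of the triangle, two coordinates of [q] move along the triangle and the
   other two feed the tripod, whose legs weigh the three further vertices. For [q] of norm at most
   1/30 the third weight is at least 1/3 - 2/30 - 6/30. *)
pose cs (q : 'rV[R]_4) := [:: 3%:R^-1 + q 0 (o 2); 3%:R^-1 + q 0 (o 3);
  3%:R^-1 + - (q 0 (o 2) + q 0 (o 3) + (lg q 0 + lg q 1 + lg q 2)); lg q 0; lg q 1; lg q 2].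
have lgc j : continuous (fun q => lg q j).
  apply: continuous_maxf; first exact: cst_continuous.
  have c0 := @coord_cont (o 0%N); have c1 := @coord_cont (o 1%N).
  have n0 := continuous_opp c0; have n1 := continuous_opp c1.
  case: j => [|[|[|j]]] /=; rewrite ?nth_nil; last exact: cst_continuous.
  - by apply: continuous_minf => //; apply: continuous_add.
  - by apply: continuous_minf => //; apply: continuous_add.
  - exact: continuous_minf.
pose tt (i : 'I_6) := nth d0 ts i; pose c (q : 'rV[R]_4) (i : 'I_6) := nth 0 (cs q) i.
apply: (@manifold_no_double 6 tt c 30%:R^-1).
- by move=> i j /eqP; rewrite /tt nth_uniq ?szts // => /eqP/val_inj.
- case=> [[|[|[|[|[|[|//]]]]]] ?]; rewrite /c /cs /=; try exact: lgc.
  + by apply: continuous_add; [exact: cst_continuous|exact: coord_cont].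
  + by apply: continuous_add; [exact: cst_continuous|exact: coord_cont].
  apply: continuous_add; first exact: cst_continuous.
  apply: continuous_opp; apply: continuous_add.
    by apply: continuous_add; exact: coord_cont.
  by apply: continuous_add => //; apply: continuous_add.
- by rewrite invr_gt0.
- move=> q q1; have qj j : `|q 0 j| <= 30%:R^-1 by apply: le_trans (mx_entry_le_norm _ _ _) q1.
  have lb j := leg_bounds j (qj (o 0)) (qj (o 1)).
  have := (lb 0%N, lb 1%N, lb 2%N, qj (o 2), qj (o 3)).
  rewrite !ler_norml -!/(lg q _).
  move=> [[[[/andP[? ?] /andP[? ?]] /andP[? ?]] /andP[? ?]] /andP[? ?]].
  split=> [||].
  - by case=> [[|[|[|[|[|[|//]]]]]] ?]; rewrite /c /cs /=; lra.
  - by rewrite !big_ord_recl big_ord0 /c /cs /=; lra.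
  have [x1 x2] := leg_exclusive (q 0 (o 0)) (q 0 (o 1)); rewrite -!/(lg q _) in x1 x2.
  have tin (i : 'I_6) : (i < 3)%N -> tt i \in t.
    by move=> i3; rewrite /tt nth_cat -cardE t3 i3 -mem_enum mem_nth // -cardE t3.
  have tt3 (i : 'I_6) : (3 <= i)%N -> tt i = nth d0 [:: d0; d1; d2] (i - 3).
    by move=> i3; rewrite /tt nth_cat -cardE t3 ltnNge i3.
  have [z1|n1] := eqVneq (lg q 1) 0; [have [z2|n2] := eqVneq (lg q 2) 0|].
  - exists s0 => //; rewrite e0; case=> [[|[|[|[|[|[|//]]]]]] ?] cn;
      rewrite !inE; try by rewrite tin ?orbT.
    + by rewrite tt3 ?eqxx.
    + by move: cn; rewrite /c /cs /= z1 eqxx.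
    + by move: cn; rewrite /c /cs /= z2 eqxx.
  - have [y1 y2] := x2 n2.
    exists s2 => //; rewrite e2; case=> [[|[|[|[|[|[|//]]]]]] ?] cn;
      rewrite !inE; try by rewrite tin ?orbT.
    + by move: cn; rewrite /c /cs /= y1 eqxx.
    + by move: cn; rewrite /c /cs /= y2 eqxx.
    + by rewrite tt3 ?eqxx.
  have [y1 y2] := x1 n1.
  exists s1 => //; rewrite e1; case=> [[|[|[|[|[|[|//]]]]]] ?] cn;
    rewrite !inE; try by rewrite tin ?orbT.
  + by move: cn; rewrite /c /cs /= y1 eqxx.
  + by rewrite tt3 ?eqxx.
  + by move: cn; rewrite /c /cs /= y2 eqxx.
move=> q _ cq; have cqj j := cq (inord j); rewrite /c in cqj.
have := (cqj 0%N, cqj 1%N, cqj 3%N, cqj 4%N, cqj 5%N).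
rewrite !inordK // /cs /= /lg !mxE => -[[[[q2 q3] l0] l1] l2].
have [q0 q1] := leg_antipodal l0 l1 l2.
apply/rowP => i; rewrite mxE -(inord_val i).
by case: i => [[|[|[|[|//]]]] ?]; rewrite -/(o _) //=; lra.
Qed.

End Manifold.

(** * Simplicial and singular chains *)

Section Labels.
Variable V : finType.
Implicit Types (s t : {set V}) (l : seq V).

(* indicator of the repetition-free enumerations of [t] *)
Fixpoint ind t l : 'F_2 :=
  if l is x :: l' then (x \in t)%:R * ind (t :\ x) l' else (t == set0)%:R.

(** The map from lists to faces, zero on lists with repetitions, commutes with boundaries; this
    compares the coefficients at [t]. *)
Lemma cobd_ind t l : cobd (ind t) l = bd (fun u => ind u l) t.
Proof.
elim: l t => [|x l IH] t.
  rewrite /cobd big_nil /bd big1 // => v _ /=; case: eqP => // /setP/(_ v).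
  by rewrite !inE eqxx.
rewrite cobd_cons /= /cobd -mulr_sumr -/(cobd _ l) IH /bd.
case: (boolP (x \in t)) => xt.
  rewrite mul1r (bigD1 x) ?setD11 //= setD1K // addrA addF2 add0r.
  apply: eq_big => v; first by rewrite !inE; case: eqP => [->|]; rewrite ?xt ?andbT.
  case/andP=> vt vx; rewrite setU1r // mul1r; congr (ind _ _).
  apply/setP => u; rewrite !inE; case: (altP (u =P v)) => [->|] //=.
  by rewrite vx.
rewrite mul0r addr0 (bigD1 x) //= setU11 mul1r setU1K // big1 ?addr0 //.
by move=> v /andP[vt vx]; rewrite !inE eq_sym (negPf vx) (negPf xt) mul0r.
Qed.

Lemma ind_support t l : ind t l != 0 -> #|t| = size l /\ {subset t <= l}.
Proof.
elim: l t => [|x l IH] t /=; first by move/F2_bool/eqP->; rewrite cards0; split=> // u; rewrite inE.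
case: (boolP (x \in t)) => xt; last by rewrite mul0r eqxx.
rewrite mul1r => /IH[tl sub]; split; first by rewrite (cardsD1 x) xt tl.
move=> u ut; rewrite inE; case: eqP => //= /eqP ux; apply: sub.
by rewrite !inE ux.
Qed.

End Labels.

Lemma facets_rem (T : eqType) (l : seq T) : uniq l ->
  facets l = [seq rem u l | u <- l].
Proof.
elim: l => //= x l IH /andP[xl ul]; rewrite eqxx IH // -map_comp; congr (_ :: _).
apply/eq_in_map => u uin /=; case: eqP => // xu.
by rewrite xu uin in xl.
Qed.

(** Removal by position, to match the numbering of the face maps of the standard simplex. *)
Definition del (T : Type) i (l : seq T) := take i l ++ drop i.+1 l.

Lemma big_facets (T : eqType) (M : nmodType) (G : seq T -> M) l n : size l = n ->
  \sum_(m <- facets l) G m = \sum_(i < n) G (del i l).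
Proof.
elim: l n G => [|x l IH] [|n] G //=; first by rewrite big_nil big_ord0.
case=> sz; rewrite big_cons big_map (IH n) // big_ord_recl /del /=.
by rewrite drop0; congr (_ + _); apply: eq_bigr.
Qed.

Lemma nth_del (T : Type) (x0 : T) i (l : seq T) j : (i < size l)%N ->
  nth x0 (del i l) j = nth x0 l (bump i j).
Proof.
move=> il; rewrite /del nth_cat size_take il /bump [(i <= j)%N]leqNgt.
case: (ltnP j i) => ji /=; first by rewrite nth_take // add0n.
by rewrite nth_drop add1n addSn subnKC.
Qed.

(** * Sperner's lemma modulo 2 *)

Section Sperner.
Variables (V : finType) (E : eqType) (b : seq E -> E) (N : nat) (P : V -> E)
  (lab : E -> V).

(** Sperner's condition, imposed on all faces at once so that it passes to faces in the
    induction. *)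
Definition proper_labels (l : seq V) := forall l', subseq l' l ->
  forall m, m \in sds b N (map P l') -> forall x, x \in m -> lab x \in l'.

Lemma sperner_other (l : seq V) (t : {set V}) : proper_labels l -> #|t| = size l ->
  t != [set x in l] -> \sum_(m <- sds b N (map P l)) ind t (map lab m) = 0.
Proof.
move=> pl tl; apply: contraNeq => sum0.
have [m ml] : exists2 m, m \in sds b N (map P l) & ind t (map lab m) != 0.
  apply/hasP; apply: contraNT sum0 => /hasPn h.
  by rewrite big_seq big1 // => m /h; rewrite negbK => /eqP.
case/ind_support => _ sub; rewrite eqEcard; apply/andP; split.
  apply/subsetP => u /sub/mapP[x xm ->]; rewrite inE.
  by apply: pl ml _ xm.
by rewrite tl cardsE; apply: card_size.
Qed.

(** The sum of [ind [set u in l]] over the facets of all small simplices is found in two ways. By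
    [cobd_ind] it counts the simplices carrying all labels of [x :: l]; by [cobd_sds] it is a sum
    over the facets of the large simplex, of which only [l] contributes. *)
Lemma sperner (l : seq V) : uniq l -> proper_labels l ->
  \sum_(m <- sds b N (map P l)) ind [set x in l] (map lab m) = 1.
Proof.
elim: l => [|x l IH].
  move=> _ _; rewrite [map P [::]]/=; elim: N => [|M IHM].
    by rewrite big_seq1 /= (_ : [set _ in _] = set0) ?eqxx //; apply/setP => u; rewrite !inE.
  by rewrite big_sds /sd /= big_seq1.
case/andP=> xl ul pl; have sl : subseq l (x :: l) by apply: subseq_cons.
have pl' : proper_labels l by move=> l' /subseq_trans/(_ sl); apply: pl.
pose t := [set u in l]; have xt : x \notin t by rewrite inE.
have tl : #|t| = size l by rewrite cardsE; apply/card_uniqP.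
have xtE : [set u in x :: l] = x |: t by apply/setP => u; rewrite !inE.
rewrite -(IH ul pl').
transitivity (\sum_(m <- sds b N (map P (x :: l))) cobd (fun m => ind t (map lab m)) m).
  under [RHS]eq_bigr do rewrite -cobd_map cobd_ind /bd.
  rewrite exchange_big /= [RHS](bigD1 x) //= [X in _ = _ + X]big1 ?addr0 ?xtE // => v /andP[vt vx].
  rewrite (sperner_other pl) //; first by rewrite cardsU1 vt tl.
  rewrite xtE; apply: contra vx => /eqP/setP/(_ v).
  by rewrite !inE eqxx (negPf (_ : v \notin l)) ?orbF //; move: vt; rewrite inE.
rewrite cobd_sds cobd_map cobd_cons -[RHS]addr0; congr (_ + _).
rewrite /cobd big_seq big1 // => l' l'l.
have sub : subseq (x :: l') (x :: l) by rewrite /= eqxx facets_subseq.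
apply: sperner_other.
- by move=> k /subseq_trans/(_ sub); apply: pl.
- by rewrite tl /= (size_facets l'l).
by apply: contra xt => /eqP->; rewrite inE mem_head.
Qed.

End Sperner.

Section Lift.
Variables (K : choiceType) (M : lmodType 'F_2) (f : K -> M).

Lemma fgliftB (D D' : {freeg K / 'F_2}) : fglift f (D - D') = fglift f D - fglift f D'.
Proof. exact: lift_is_additive. Qed.

Lemma fglift0 : fglift f 0 = 0.
Proof. by rewrite -[0 in LHS](subrr 0) fgliftB subrr. Qed.

Lemma fgliftD (D D' : {freeg K / 'F_2}) : fglift f (D + D') = fglift f D + fglift f D'.
Proof. by rewrite -[D' in LHS]opprK -[- D']sub0r !fgliftB fglift0 sub0r opprK. Qed.

Lemma fglift_sum (I : Type) (r : seq I) (P : pred I) (D : I -> {freeg K / 'F_2}) :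
  fglift f (\sum_(i <- r | P i) D i) = \sum_(i <- r | P i) fglift f (D i).
Proof. exact: (big_morph _ fgliftD fglift0). Qed.

End Lift.

Lemma freegZ (K : choiceType) (c : 'F_2) (x : K) : << c *g x >> = c *: << x >>.
Proof.
by apply/eqP/freeg_eqP => y /=; rewrite coeffZ !coeffU mul1r.
Qed.

(** Reconciles two descriptions of the boundary: deleting points from faces, and collecting
    coefficients by adding points. *)
Lemma bd_dual (V : finType) (M : lmodType 'F_2) (w : {set V} -> 'F_2)
    (G : {set V} -> M) :
  \sum_(s : {set V}) w s *: (\sum_(u in s) G (s :\ u)) = \sum_(t : {set V}) bd w t *: G t.
Proof.
under eq_bigr do rewrite scaler_sumr.
under [RHS]eq_bigr do rewrite /bd scaler_suml.
rewrite (exchange_big_dep predT) //= [RHS](exchange_big_dep predT) //=.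
apply: eq_bigr => u _.
rewrite (reindex_onto (fun t : {set V} => u |: t) (fun s => s :\ u)) /=; last first.
  by move=> s us; rewrite setD1K.
apply: eq_big => [t|t /andP[_ /eqP->]//].
rewrite setU11 /=; apply/eqP/idP => [<-|ut]; first by rewrite setD11.
exact: setU1K.
Qed.

(** * Affine singular simplices spanned by faces *)

Section AffineSimplex.
Variables (R : realType) (k : nat).

Definition vmx n (ps : seq 'rV[R]_k) : 'M[R]_(n.+1, k) := \matrix_(i < n.+1) nth 0 ps i.

Definition aff n (ps : seq 'rV[R]_k) (t : classical_sets.set_type (std_simplex R n)) : 'rV[R]_k :=
  set_val t *m vmx n ps.

Lemma face_vec_mul n (i : 'I_n.+2) (ps : seq 'rV[R]_k) (t : 'rV[R]_n.+1) :
  size ps = n.+2 -> face_vec i t *m vmx n.+1 ps = t *m vmx n (del i ps).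
Proof.
move=> sz; apply/rowP => j; rewrite !mxE (bigD1_ord i) //= !mxE unlift_none /= mul0r add0r.
apply: eq_bigr => l _; rewrite !mxE liftK /=; congr (_ * _).
by rewrite nth_del ?sz.
Qed.

Lemma aff_coface n (i : 'I_n.+2) (ps : seq 'rV[R]_k) : size ps = n.+2 ->
  @aff n.+1 ps \o coface i = @aff n (del i ps).
Proof. by move=> sz; apply: funext => t; apply: face_vec_mul. Qed.

Lemma boundary_aff n (ps : seq 'rV[R]_k) : size ps = n.+2 ->
  boundary << @aff n.+1 ps >> = \sum_(l <- facets ps) << @aff n l >>.
Proof.
move=> sz; rewrite /boundary liftU scale1r (big_facets _ sz).
by apply: eq_bigr => i _; rewrite aff_coface.
Qed.

Variables (V : finType) (p : V -> 'rV[R]_k).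

Definition face_pts (s : {set V}) := map p (enum s).

(** [enum] orders the vertices consistently in all faces; [z] is meant to vanish on sets without n +
    1 elements. *)
Definition sing n (z : {set V} -> 'F_2) : chain R n 'rV[R]_k :=
  \sum_(s : {set V}) << z s *g @aff n (face_pts s) >>.

Lemma rem_enum (s : {set V}) u : rem u (enum s) = enum (s :\ u).
Proof.
rewrite rem_filter ?enum_uniq // /enum_mem -filter_predI.
by apply: eq_filter => v; rewrite /= !inE.
Qed.

Lemma boundary_sing n (w : {set V} -> 'F_2) :
  (forall s, w s != 0 -> #|s| = n.+2) -> boundary (sing n.+1 w) = sing n (bd w).
Proof.
move=> wn; rewrite {1}/boundary /sing fglift_sum.
under [RHS]eq_bigr do rewrite freegZ.
rewrite -(bd_dual w (fun t => << @aff n (face_pts t) >>)); apply: eq_bigr => s _.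
have [->|/wn ws] := eqVneq (w s) 0; first by rewrite freegU0 fglift0 scale0r.
rewrite liftU; congr (_ *: _).
have sz : size (face_pts s) = n.+2 by rewrite size_map -cardE.
have := boundary_aff sz; rewrite /boundary liftU scale1r => ->.
rewrite /face_pts facets_map facets_rem ?enum_uniq // !big_map big_enum /=.
by apply: eq_bigr => u _; rewrite rem_enum.
Qed.

End AffineSimplex.

(** * Closed conditions and compactness of the standard simplex *)

Lemma closed_forall (T : topologicalType) (I : Type) (P : I -> T -> Prop) :
  (forall i, closed [set y | P i y]) -> closed [set y | forall i, P i y].
Proof.
move=> cP; rewrite (_ : [set _ | _] = \bigcap_i [set y | P i y]).
  by apply: closed_bigI.
by apply/seteqP; split => y h i; [move=> _|]; exact: h.
Qed.

Lemma closed_imply (T : topologicalType) (b : bool) (P : T -> Prop) :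
  closed [set y | P y] -> closed [set y | b -> P y].
Proof.
case: b => cP; last by rewrite (_ : [set _ | _] = classical_sets.setT) ?closedT //; apply/seteqP.
by rewrite (_ : [set _ | _] = [set y | P y]) //; apply/seteqP; split => y /=; auto.
Qed.

Lemma closed_exists (T : topologicalType) (I : finType) (A : {pred I}) (P : I -> T -> Prop) :
  (forall i, closed [set y | P i y]) -> closed [set y | exists2 i, i \in A & P i y].
Proof.
move=> cP; rewrite (_ : [set _ | _] = \bigcup_(i in [set i | i \in A]) [set y | P i y]).
  by apply: closed_bigcup => // i _; apply: cP.
by apply/seteqP; split => y [i iA Py]; exists i.
Qed.

Lemma closed_and (T : topologicalType) (P Q : T -> Prop) :
  closed [set y | P y] -> closed [set y | Q y] -> closed [set y | P y /\ Q y].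
Proof. by move=> cP cQ; apply: (closedI cP cQ). Qed.

Lemma closed_nonneg (R : realType) (T : topologicalType) (f : T -> R) :
  continuous f -> closed [set y | 0 <= f y].
Proof.
move=> cf; apply: (@preimage_closed _ R f [set x | 0 <= x]); last exact: closed_ge.
by move=> x _; apply: cf.
Qed.

Lemma closed_eqc (R : realType) (T : topologicalType) (f : T -> R) (c : R) :
  continuous f -> closed [set y | f y = c].
Proof.
move=> cf; apply: (@preimage_closed _ R f [set x | x = c]); last exact: closed_eq.
by move=> x _; apply: cf.
Qed.

Lemma continuous_sum_coord (R : realType) (n : nat) (I : finType) (f : I -> 'I_n) :
  continuous (fun y : 'rV[R]_n => \sum_i y 0 (f i)).
Proof.
apply: continuous_big; first exact: add_continuous.
by move=> i _; apply: coord_continuous.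
Qed.

Lemma nonneg_sum1_le1 (R : realType) (I : finType) (f : I -> R) i :
  (forall j, 0 <= f j) -> \sum_j f j = 1 -> f i <= 1.
Proof.
by move=> f0 <-; rewrite (bigD1 i) //= lerDl sumr_ge0.
Qed.

Lemma std_simplex_compact (R : realType) (n : nat) : compact (std_simplex R n).
Proof.
apply: bounded_closed_compact.
  exists 1; split=> [|M M1 x [x0 x1]]; first exact: num_real.
  apply: mx_norm_le => [|i j]; first by apply: ltW; apply: lt_trans M1.
  rewrite ord1 ger0_norm //; apply: le_trans (ltW M1).
  exact: (nonneg_sum1_le1 (f := fun j => x 0 j)).
apply: closed_and; last by apply: closed_eqc; apply: continuous_sum_coord.
by apply: closed_forall => i; apply: closed_nonneg; apply: coord_continuous.
Qed.

Lemma subtype_nbhs_ball (R : realType) (T : pseudoMetricType R) (A : set T)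
    (t : classical_sets.set_type A) (P : set (classical_sets.set_type A)) : nbhs t P ->
  exists2 r, 0 < r & forall t', ball (set_val t) r (set_val t') -> P t'.
Proof.
case=> _ /= [] [W oW <-] /= Wx WP.
have /nbhs_ballP[r r0 rW] := open_nbhs_nbhs (conj oW Wx).
by exists r => // t' /rW/WP.
Qed.

(** * Labelling the points above a hyperplane by vertices *)

Section Labelling.
Variables (R : realType) (V : finType) (C : {set {set V}}).
Variables (k : nat) (p : V -> 'rV[R]_k) (dir : 'rV[R]_k) (a : R) (v0 : V).
Hypotheses (C_complex : simplicial_complex C) (p_emb : linear_embedding C p).

Let ht u := dotp dir (p u).
Let X := polyhedron C p.

Definition weights (x : 'rV[R]_k) : {ffun V -> R} :=
  xget [ffun=> 0] [set w | barycentric R C w /\ affine_ext p w = x].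

Lemma weightsP x : X x -> barycentric R C (weights x) /\ affine_ext p (weights x) = x.
Proof.
case=> w wC wx; apply: (@xgetPex _ [ffun=> 0]
  (fun w => barycentric R C w /\ affine_ext p w = x)).
by exists w.
Qed.

Lemma weights_affine w : barycentric R C w -> weights (affine_ext p w) = w.
Proof.
move=> wC; have [|h1 h2] := @weightsP (affine_ext p w); first by exists w.
by apply: p_emb => //; apply/mem_set.
Qed.

Definition lab x : V := odflt v0
  [pick u | (a < ht u) && [forall u', (a < ht u') ==> (weights x u' <= weights x u)]].

Lemma dotp_affine w : dotp dir (affine_ext p w) = \sum_v w v * ht v.
Proof.
rewrite /dotp /affine_ext; under eq_bigr do rewrite summxE mulr_sumr.
rewrite exchange_big; apply: eq_bigr => v _ /=; rewrite /ht /dotp mulr_sumr.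
by apply: eq_bigr => i _; rewrite mxE mulrCA.
Qed.

(** The height of [x] is the weighted mean of the heights of the vertices, so a point above the
    hyperplane gives positive weight to some vertex above it. *)
Lemma lab_spec x : (open_half dir a `&` X) x ->
  [/\ a < ht (lab x), 0 < weights x (lab x) &
      forall u, a < ht u -> weights x u <= weights x (lab x)].
Proof.
case=> hx Xx; have [[w0 [w1 _]] wx] := weightsP Xx.
have [u au wu] : exists2 u, a < ht u & 0 < weights x u.
  apply: contrapT => no; move: hx; rewrite /open_half /= -wx dotp_affine ltNge.
  rewrite -[a]mul1r -w1 mulr_suml => /negP; apply.
  apply: ler_sum => v _; case: (leP (ht v) a) => av; first exact: ler_wpM2l.
  suff -> : weights x v = 0 by rewrite !mul0r.
  by apply/eqP; apply: contraT => wv; case: no; exists v; rewrite // lt0r wv w0.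
rewrite /lab; case: pickP => [u1 /andP[au1 /forallP u1max]|/=].
  have le u' : a < ht u' -> weights x u' <= weights x u1 by apply/implyP.
  by split=> //=; apply: lt_le_trans wu _; apply: le.
case: (arg_maxP (P := fun u => a < ht u) (weights x) au) => u1 au1 u1max /(_ u1).
rewrite au1 /=; move/negbT/forallP; case=> u'.
by apply/implyP => au'; apply: u1max.
Qed.

Definition argmax_region u := affine_ext p @`
  [set w | barycentric R C w /\ forall u', a < ht u' -> w u' <= w u].

(** It is the continuous image of a compact set of weights, which spares a proof that [weights] is
    continuous. *)
Lemma argmax_region_closed u : closed (argmax_region u).
Proof.
pose wt (y : 'rV[R]_#|V|) v := y 0 (enum_rank v).
pose K : set 'rV[R]_#|V| := [set y | (forall v, 0 <= wt y v) /\ (\sum_v wt y v = 1 /\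
  ((exists2 s, s \in C & forall v, v \notin s -> wt y v = 0) /\
   forall u', a < ht u' -> 0 <= wt y u - wt y u'))].
have wc v : continuous (wt^~ v) by apply: coord_continuous.
have cK : compact K.
  apply: bounded_closed_compact.
    exists 1; split=> [|M M1 x [x0 [x1 _]]]; first exact: num_real.
    apply: mx_norm_le => [|i j]; first by apply: ltW; apply: lt_trans M1.
    rewrite ord1 -(enum_valK j) ger0_norm; last exact: x0.
    by apply: le_trans (ltW M1); apply: (nonneg_sum1_le1 (f := wt x)).
  apply: closed_and; first by apply: closed_forall => v; apply: closed_nonneg.
  apply: closed_and; first by apply: closed_eqc; apply: continuous_sum_coord.
  apply: closed_and.
    apply: closed_exists => s; apply: closed_forall => v; apply: closed_imply.
    exact: closed_eqc.
  apply: closed_forall => u'; apply: closed_imply; apply: closed_nonneg.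
  by apply: continuous_add => //; apply: continuous_opp.
rewrite (_ : argmax_region u = (fun y => \sum_v wt y v *: p v) @` K).
  apply: compact_closed; first exact: norm_hausdorff.
  apply: continuous_compact cK; apply: continuous_subspaceT.
  exact: continuous_lincomb.
apply/seteqP; split => [x [w [[w0 [w1 [s sC ws]]] wmax] <-]|x [y [y0 [y1 [[s sC ys] ymax]]] <-]].
  exists (\row_i w (enum_val i)); last first.
    by apply: eq_bigr => v _; rewrite /wt mxE enum_rankK.
  have E v : wt (\row_i w (enum_val i)) v = w v by rewrite /wt mxE enum_rankK.
  split=> [v|]; first by rewrite E.
  split; first by rewrite -w1; apply: eq_bigr => v _; rewrite E.
  split; first by exists s => // v vs; rewrite E ws.
  by move=> u' au'; rewrite !E subr_ge0 wmax.
exists [ffun v => wt y v]; last first.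
  by apply: eq_bigr => v _; rewrite ffunE.
split=> [|u' au']; last by rewrite !ffunE -subr_ge0 ymax.
split=> [v|]; first by rewrite ffunE.
split; first by rewrite -y1; apply: eq_bigr => v _; rewrite ffunE.
by exists s => // v vs; rewrite ffunE ys.
Qed.

(** Subdivision works with rows, singular simplices with a subtype; 0 is a default value off the
    standard simplex. *)
Definition ext (m : nat) (s : classical_sets.set_type (std_simplex R m) -> 'rV[R]_k)
  (x : 'rV[R]_m.+1) : 'rV[R]_k := oapp s 0 (insub x).

Lemma ext_val m (s : classical_sets.set_type (std_simplex R m) -> 'rV[R]_k) t :
  ext s (set_val t) = s t.
Proof. by rewrite /ext valK. Qed.

Definition corners m : seq 'rV[R]_m.+1 := [seq delta_mx 0 i | i <- enum 'I_m.+1].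

Lemma std_simplex_convex m N l x : l \in sds (@bary R m.+1) N (corners m) -> x \in l ->
  std_simplex R m x.
Proof.
move=> lb xl; have e (i : 'I_m.+1) j : (delta_mx 0 i : 'rV[R]_m.+1) 0 j = (j == i)%:R.
  by rewrite mxE eqxx.
split.
  move=> i; apply: (sds_closed (@bary_entry_ge0 R m.+1 i) _ lb xl).
  by move=> y /mapP[j _ ->]; rewrite e.
have : x *m const_mx 1 = const_mx 1 :> 'rV[R]_1.
  apply: (sds_closed (@bary_mulmx_eq R _ _ (const_mx 1) (const_mx 1)) _ lb xl).
  move=> y /mapP[j _ ->]; apply/rowP => i; rewrite !mxE (bigD1 j) //= !mxE !eqxx mulr1.
  by rewrite big1 ?addr0 // => l' l'j; rewrite e (negPf l'j) mul0r.
move=> /rowP/(_ 0); rewrite !mxE => <-.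
by apply: eq_bigr => i _; rewrite mxE mulr1.
Qed.

(** Near [t] all labels lie in the face of vertices above [a] with positive weight at [s t]: for any
    other vertex above [a], the closed region where its weight is maximal misses [s t]. A Lebesgue
    number makes this uniform. *)
Lemma fine_labels m (s : classical_sets.set_type (std_simplex R m) -> 'rV[R]_k) :
  continuous s -> (forall t, (open_half dir a `&` X) (s t)) ->
  exists N0, forall N, (N0 <= N)%N -> forall l, l \in sds (@bary R m.+1) N (corners m) ->
  exists2 f, f \in above C ht a & forall x, x \in l -> lab (ext s x) \in f.
Proof.
move=> sc sX; pose fine (S : set 'rV[R]_m.+1) :=
  exists2 f, f \in above C ht a & forall x, S x -> lab (ext s x) \in f.
have loc (x : 'rV[R]_m.+1) : std_simplex R m x ->
    exists2 r, 0 < r & fine (ball x r `&` std_simplex R m).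
  move=> xK; pose t : classical_sets.set_type (std_simplex R m) := SigSub (mem_set xK).
  have [at0 wt0 tmax] := lab_spec (sX t).
  have [hst Xst] := sX t; have [[w0 [w1 [g gC gw]]] wst] := weightsP Xst.
  pose f := [set u | (a < ht u) && (0 < weights (s t) u)]%SET.
  have fa : f \in above C ht a.
    rewrite inE; apply/andP; split; last first.
      by apply/forall_inP => u; rewrite inE => /andP[].
    have [_ Cdown] := C_complex; apply: Cdown gC _ _.
      by apply/set0Pn; exists (lab (s t)); rewrite inE at0.
    apply/subsetP => u; rewrite inE => /andP[_]; apply: contraTT => /gw->.
    by rewrite ltxx.
  have near_u u : \forall y \near x, forall t', set_val t' = y -> u \notin f ->
      lab (s t') != u.
    case: (boolP (u \in f)) => uf; first by apply: (@nearW _ (nbhs x)) => y t' _ /negP[].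
    case: (boolP (a < ht u)) => au; last first.
      apply: (@nearW _ (nbhs x)) => y t' _ _; apply: contraNneq au => <-.
      by have [] := lab_spec (sX t').
    have nst : (~` argmax_region u) (s t).
      move=> [w [wC wmax] ws]; have {}ws : weights (s t) = w.
        by rewrite -ws weights_affine.
      move: uf; rewrite inE au /= ws => /negP; apply.
      by apply: lt_le_trans (wmax _ at0); rewrite -ws.
    have := sc t (~` argmax_region u)
      (open_nbhs_nbhs (conj (closed_openC (@argmax_region_closed u)) nst)).
    case/subtype_nbhs_ball => r r0 hr; apply/nbhs_ballP; exists r => // y xy t' ty _.
    apply/eqP => e; have /= := hr t'; rewrite ty => /(_ xy); apply.
    have [hst' Xst'] := sX t'; have [wC ws'] := weightsP Xst'.
    exists (weights (s t')) => //; split=> // u' au'; rewrite -e.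
    by have [_ _] := lab_spec (sX t'); apply.
  have /nbhs_ballP[r r0 hr] : \forall y \near x, forall u t', set_val t' = y ->
      u \notin f -> lab (s t') != u.
    exact: (@filter_forall _ _ _ (nbhs x)).
  exists r => //; exists f => // y [xy yK].
  have -> : y = set_val (SigSub (mem_set yK) : classical_sets.set_type (std_simplex R m)) by [].
  rewrite ext_val; apply: contraT => nf.
  by have := hr y xy _ (SigSub (mem_set yK)) erefl nf; rewrite eqxx.
have fineW A B : A `<=` B -> fine B -> fine A.
  by move=> AB [f fa Bf]; exists f => // x /AB/Bf.
have [d d0 hd] := lebesgue_number (@std_simplex_compact R m) fineW loc.
have [N0 hN] := sds_mesh (corners m) d0; exists N0 => N NN l lb.
case: l lb => [/size_sds|x l lb]; first by rewrite size_map size_enum_ord.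
have xK : std_simplex R m x by apply: std_simplex_convex lb _; rewrite mem_head.
have [f fa hf] := hd x xK; exists f => // y yl; apply: hf; split.
  by rewrite mx_norm_ball /ball_ /=; apply: (hN N NN _ lb); rewrite ?mem_head.
exact: std_simplex_convex lb yl.
Qed.

End Labelling.

Section Corners.
Variable R : realType.

Lemma row_vmx (k m : nat) (ps : seq 'rV[R]_k) (i : 'I_m.+1) : row i (vmx m ps) = nth 0 ps i.
Proof. by apply/rowP => j; rewrite !mxE. Qed.

Lemma corners_map (k m : nat) (ps : seq 'rV[R]_k) : size ps = m.+1 ->
  map (mulmxr (vmx m ps)) (corners R m) = ps.
Proof.
move=> sz; rewrite /corners -map_comp -[RHS](mkseq_nth 0) sz /mkseq -val_enum_ord -map_comp.
by apply: eq_map => i /=; rewrite -rowE row_vmx.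
Qed.

Lemma size_corners m : size (corners R m) = m.+1.
Proof. by rewrite size_map size_enum_ord. Qed.

Lemma vmx_corners m : vmx m (corners R m) = 1%:M.
Proof.
apply/row_matrixP => i; rewrite row_vmx row1 (nth_map i) ?size_enum_ord //.
by rewrite nth_ord_enum.
Qed.

Lemma size_del (T : Type) i (l : seq T) : (i < size l)%N -> size (del i l) = (size l).-1.
Proof. by move=> il; rewrite size_cat size_take il size_drop; lia. Qed.

(** Face maps are linear, hence commute with barycentres and with subdivision. *)
Lemma face_vecE m (i : 'I_m.+2) (x : 'rV[R]_m.+1) :
  face_vec i x = mulmxr (vmx m (del i (corners R m.+1))) x.
Proof.
by rewrite /= -face_vec_mul ?size_corners // vmx_corners mulmx1.
Qed.

Lemma face_vec_corners m (i : 'I_m.+2) :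
  map (@face_vec R m i) (corners R m) = del i (corners R m.+1).
Proof.
rewrite (eq_map (@face_vecE m i)) corners_map // size_del size_corners //.
Qed.

Lemma face_vec_bary m (i : 'I_m.+2) (s : seq 'rV[R]_m.+1) :
  bary (map (face_vec i) s) = face_vec i (bary s).
Proof. by rewrite (eq_map (@face_vecE m i)) bary_mul face_vecE. Qed.

End Corners.

(** * Simplicial fillings from singular ones *)

Section Tight.
Variables (R : realType) (V : finType) (C : {set {set V}}).
Variables (k : nat) (p : V -> 'rV[R]_k) (dir : 'rV[R]_k) (a : R).
Hypotheses (C_complex : simplicial_complex C) (p_emb : linear_embedding C p).

Let ht u := dotp dir (p u).
Let X := polyhedron C p.
Let Xa : set 'rV[R]_k := open_half dir a `&` X.

Lemma aff_list m (l : seq V) (s : {set V}) (t : 'rV[R]_m.+1) : size l = m.+1 ->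
  {subset l <= s} -> s \in C -> std_simplex R m t ->
  exists w, [/\ barycentric R C w, forall v, v \notin l -> w v = 0 &
    t *m vmx m (map p l) = affine_ext p w].
Proof.
move=> sz ls sC [t0 t1].
have [v0 _] : exists v, v \in l by case: l sz {ls} => // v l; exists v; rewrite mem_head.
have ll i : t 0 i != 0 -> nth v0 l i \in s by move=> _; apply: ls; rewrite mem_nth ?sz.
have [wC we] := barycentric_lincomb p t0 t1 sC ll.
exists [ffun v => \sum_i t 0 i * (v == nth v0 l i)%:R]; split=> // [v vl|].
  rewrite ffunE big1 // => i _; case: eqP => [vi|_]; last by rewrite mulr0.
  by rewrite vi mem_nth ?sz in vl.
rewrite we mulmx_sum_row; apply: eq_bigr => i _.
by rewrite row_vmx (nth_map v0) ?sz.
Qed.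

Lemma affine_high w : barycentric R C w -> (forall v, w v != 0 -> a < ht v) ->
  Xa (affine_ext p w).
Proof.
move=> wC wh; split; last by exists w.
have [w0 [w1 _]] := wC; rewrite /open_half /= dotp_affine ltNge; apply/negP => le.
have ge v : 0 <= w v * (ht v - a).
  have [->|/wh av] := eqVneq (w v) 0; first by rewrite mul0r.
  by rewrite mulr_ge0 // subr_ge0 ltW.
have s0 : \sum_v w v * (ht v - a) = 0.
  apply/eqP; rewrite eq_le sumr_ge0 // andbT.
  under eq_bigr do rewrite mulrBr.
  by rewrite sumrB -mulr_suml w1 mul1r subr_le0.
have z v : w v = 0.
  apply/eqP; apply: contraT => wv.
  have /eqP : w v * (ht v - a) = 0 by apply: (psumr_eq0P (fun v _ => ge v) s0).
  by rewrite mulf_eq0 (negPf wv) subr_eq0 gt_eqF // wh.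
by move: w1; rewrite big1 // => /eqP; rewrite eq_sym oner_eq0.
Qed.

Lemma above_high s v : s \in above C ht a -> v \in s -> a < ht v.
Proof. by rewrite inE => /andP[_ /forall_inP h] /h. Qed.

Lemma above_sub s : s \in above C ht a -> s \in C.
Proof. by rewrite inE => /andP[]. Qed.

Lemma aff_continuous m (ps : seq 'rV[R]_k) : continuous (@aff R k m ps).
Proof.
move=> t; apply: (@continuous_comp _ _ _ (set_val : _ -> 'rV[R]_m.+1) (fun x => x *m vmx m ps)).
  exact: initial_continuous.
rewrite (_ : (fun x => x *m vmx m ps) = fun x : 'rV[R]_m.+1 => \sum_i x 0 i *: row i (vmx m ps)).
  by apply: continuous_lincomb => i; apply: coord_continuous.
by apply: funext => x; rewrite mulmx_sum_row.
Qed.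

Lemma aff_face_in m s t : s \in C -> #|s| = m.+1 -> X (@aff R k m (face_pts p s) t).
Proof.
move=> sC sm; have [|v|//|w [wC _ e]] := @aff_list m (enum s) s (set_val t) _ _ sC.
- by rewrite -cardE.
- by rewrite mem_enum.
- exact: set_mem (valP t).
by exists w => //; rewrite /aff e.
Qed.

Lemma aff_above_in m s t : s \in above C ht a -> #|s| = m.+1 ->
  Xa (@aff R k m (face_pts p s) t).
Proof.
move=> sa sm; have [|v|||w [wC ws e]] := @aff_list m (enum s) s (set_val t).
- by rewrite -cardE.
- by rewrite mem_enum.
- exact: above_sub.
- exact: set_mem (valP t).
rewrite /aff e; apply: affine_high => // v wv; apply: above_high sa _.
by rewrite -mem_enum; apply: contraNT wv => /ws->.
Qed.

Lemma dom_sing m z g : g \in dom (@sing R k V p m z) ->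
  exists2 s, z s != 0 & g = @aff R k m (face_pts p s).
Proof.
move/dom_sum_subset => /flatten_mapP[s _].
have [->|zs] := eqVneq (z s) 0; first by rewrite freegU0 dom0.
by rewrite domU // inE => /eqP->; exists s.
Qed.

Lemma singular_sing m (z : {set V} -> 'F_2) (Y : set 'rV[R]_k) :
  (forall s t, z s != 0 -> Y (@aff R k m (face_pts p s) t)) ->
  singular_chain Y (@sing R k V p m z).
Proof.
move=> zY g /dom_sing[s zs ->]; split=> [|t]; first exact: aff_continuous.
exact: zY.
Qed.

Lemma sing_eq m z z' : z =1 z' -> @sing R k V p m z = @sing R k V p m z'.
Proof. by move=> zz; apply: eq_bigr => s _; rewrite zz. Qed.

Lemma sing0 m : @sing R k V p m (fun=> 0) = 0.
Proof. by apply: big1 => s _; rewrite freegU0. Qed.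

(** A point in the span of [l] has positive weight at vertices of [l] only, and its label has
    positive weight. *)
Lemma face_labels v0 N (s : {set V}) : s \in above C ht a ->
  proper_labels (@bary R k) N p (lab C p dir a v0) (enum s).
Proof.
move=> sa l ls m ml x xm; have := size_sds ml; rewrite size_map.
case sz: (size l) => [|j]; first by move/eqP; rewrite size_eq0 => /eqP m0; rewrite m0 in xm.
have sz' : size (map p l) = j.+1 by rewrite size_map.
have lin v : v \in l -> v \in s by rewrite -[v \in s]mem_enum; apply: mem_subseq.
rewrite -(corners_map sz') (sds_map (@bary_mul R _ _ _)) in ml.
case/mapP: ml xm => m' m'b -> /mapP[y ym' ->] _.
have [w [wC wl e]] := aff_list sz lin (above_sub sa) (std_simplex_convex m'b ym').
have xa : Xa (y *m vmx j (map p l)).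
  rewrite e; apply: affine_high => // v wv; apply: above_high sa _; apply: lin.
  by apply: contraNT wv => /wl->.
rewrite /=; have [_ + _] := lab_spec v0 xa; rewrite {1}e weights_affine //.
by apply: contraTT => /wl->; rewrite ltxx.
Qed.

Section Evaluation.
Variables (v0 : V) (N : nat).
Let lb := lab C p dir a v0.

(* counts the simplices of the [N]-th barycentric subdivision of [g] whose
   vertices are labelled bijectively by [t] *)
Definition label_count m (t : {set V}) (g : classical_sets.set_type (std_simplex R m) -> 'rV[R]_k) :
  'F_2 := \sum_(l <- sds (@bary R m.+1) N (corners R m)) ind t (map (lb \o ext g) l).

Lemma label_count_card m t g : label_count (m := m) t g != 0 -> #|t| = m.+1.
Proof.
move=> ne0; have [l lN /ind_support[-> _]] : exists2 l,
    l \in sds (@bary R m.+1) N (corners R m) & ind t (map (lb \o ext g) l) != 0.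
  apply/hasP; apply: contraNT ne0 => /hasPn h; rewrite /label_count.
  by rewrite big_seq big1 // => l /h; rewrite negbK => /eqP.
by rewrite size_map (size_sds lN) size_corners.
Qed.

(** Subdividing and labelling is a chain map from singular to simplicial chains; this is its
    coefficient at [t], obtained from [cobd_sds] and [cobd_ind]. *)
Lemma label_count_coface m t (g : classical_sets.set_type (std_simplex R m.+1) -> 'rV[R]_k) :
  \sum_(i < m.+2) label_count t (g \o coface i) =
  \sum_(v | v \notin t) label_count (v |: t) g.
Proof.
pose G l := \sum_(l' <- sds (@bary R m.+2) N l) ind t (map (lb \o ext g) l').
transitivity (\sum_(i < m.+2) G (del i (corners R m.+1))).
  apply: eq_bigr => i _; rewrite /G -face_vec_corners (sds_map (@face_vec_bary R m i)) big_map.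
  apply: eq_big_seq => l lN; congr (ind t _); rewrite -map_comp.
  apply/eq_in_map => x xl /=; congr lb.
  have xK := std_simplex_convex lN xl.
  have -> : x = set_val (SigSub (mem_set xK) : classical_sets.set_type (std_simplex R m)) by [].
  by rewrite ext_val -[face_vec i _]/(set_val (coface i _)) ext_val.
rewrite -big_facets ?size_corners // -/(cobd G _) -cobd_sds exchange_big.
by apply: eq_bigr => l _; rewrite -cobd_map cobd_ind.
Qed.

Lemma label_count_aff m s t : s \in above C ht a -> #|s| = m.+1 ->
  label_count t (@aff R k m (face_pts p s)) = (s == t)%:R.
Proof.
move=> sa sm; have sz : size (face_pts p s) = m.+1 by rewrite size_map -cardE.
have -> : label_count t (@aff R k m (face_pts p s)) =
    \sum_(l <- sds (@bary R k) N (map p (enum s))) ind t (map lb l).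
  rewrite -[map p _]/(face_pts p s) -[in RHS](corners_map sz).
  rewrite (sds_map (@bary_mul R _ _ _)) big_map.
  apply: eq_big_seq => l lN; congr (ind t _); rewrite -map_comp.
  apply/eq_in_map => x xl /=; congr lb.
  have xK := std_simplex_convex lN xl.
  have -> : x = set_val (SigSub (mem_set xK) : classical_sets.set_type (std_simplex R m)) by [].
  by rewrite ext_val.
have es : [set x in enum s]%SET = s by apply/setP => x; rewrite inE mem_enum.
have pl := @face_labels v0 N s sa.
case: eqP => [<-|st]; first by rewrite -{2}es sperner ?enum_uniq.
case: (altP (#|t| =P #|s|)) => ts.
  by apply: sperner_other pl _ _; rewrite -?cardE // es; apply/eqP => ts'; apply: st.
rewrite big_seq big1 // => l lN; apply/eqP; apply: contraNT ts => /ind_support[-> _].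
by rewrite size_map (size_sds lN) size_map -cardE.
Qed.

End Evaluation.

Lemma common_bound (A : eqType) (r : seq A) (P : A -> nat -> Prop) :
  (forall x, x \in r -> exists N0, forall N, (N0 <= N)%N -> P x N) ->
  exists N, forall x, x \in r -> P x N.
Proof.
move=> h; suff [N hN] : exists N0, forall N, (N0 <= N)%N -> forall x, x \in r -> P x N.
  by exists N; apply: hN.
elim: r h => [|x r IH] h; first by exists 0%N.
have [|N1 h1] := IH; first by move=> y yr; apply: h; rewrite inE yr orbT.
have [N2 h2] := h x (mem_head _ _); exists (maxn N1 N2) => N.
rewrite geq_max => /andP[l1 l2] y; rewrite inE => /orP[/eqP->|yr]; first exact: h2.
exact: h1.
Qed.

Hypothesis X_tight : tight dir X.

Lemma tight_simplicial : tight_at C ht a.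
Proof.
move=> n z w zK wC dw.
(* The zero chain is treated apart, since the labelling needs a default vertex [v0], taken here from
   a face of [z]. *)
have [/forallP z0|] := boolP [forall s, z s == 0].
  exists (fun=> 0); split=> [s|t]; first by rewrite eqxx.
  by rewrite (eqP (z0 t)) /bd big1.
move=> /forallPn[s0 zs0]; have [s0a s0n] := zK s0 zs0.
have /card_gt0P[v0 _] : (0 < #|s0|)%N by rewrite s0n.
have z_in s t : z s != 0 -> Xa (@aff R k n (face_pts p s) t).
  by move=> /zK[sa sn]; apply: aff_above_in.
have w_in s t : w s != 0 -> X (@aff R k n.+1 (face_pts p s) t).
  by move=> /wC[sC sn]; apply: aff_face_in.
have zcycle : singular_cycle Xa (@sing R k V p n z).
  split; first exact: singular_sing.
  case: n zK {wC w_in z_in s0n} => //= n zK.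
  rewrite boundary_sing; last by move=> s /zK[].
  rewrite -[RHS](sing0 n); apply: sing_eq => t.
  by rewrite -(eq_bd dw) bd_bd.
have cycle0 : singular_cycle Xa (0 : chain R n 'rV[R]_k).
  split; first by move=> g; rewrite dom0.
  by case: (n) => //= m; rewrite /boundary fglift0.
have [|b bX eb] := @X_tight a n _ _ zcycle cycle0.
  exists (@sing R k V p n.+1 w); first exact: singular_sing.
  rewrite subr0 boundary_sing; last by move=> s /wC[].
  by apply: sing_eq => t; rewrite dw.
have [N hN] : exists N, forall g, g \in dom b -> forall l,
    l \in sds (@bary R n.+2) N (corners R n.+1) ->
    exists2 f, f \in above C ht a & forall x, x \in l -> lab C p dir a v0 (ext g x) \in f.
  apply: common_bound => g gb; have [gc gX] := bX g gb.
  exact: (fine_labels v0 C_complex p_emb gc gX).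
pose H m := @label_count v0 N m.
(* The image of [b] under subdivision and labelling; [N] is fine enough for all the finitely many
   simplices of [b]. *)
pose w' u := \sum_(g <- dom b) coeff g b * H n.+1 u g.
exists w'; split=> [u w'u|t].
  have [g gb Hg] : exists2 g, g \in dom b & H n.+1 u g != 0.
    apply/hasP; apply: contraNT w'u => /hasPn h; rewrite /w' big_seq big1 // => g /h.
    by rewrite negbK => /eqP->; rewrite mulr0.
  have cu := label_count_card Hg; split=> //.
  have [l lN /ind_support[_ sub]] : exists2 l, l \in sds (@bary R n.+2) N (corners R n.+1) &
      ind u (map (lab C p dir a v0 \o ext g) l) != 0.
    apply/hasP; apply: contraNT Hg => /hasPn h; rewrite /H /label_count.
    by rewrite big_seq big1 // => l /h; rewrite negbK => /eqP.
  have [f fa hf] := hN g gb l lN.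
  have uf : u \subset f by apply/subsetP => v /sub/mapP[x xl ->]; apply: hf.
  rewrite inE; apply/andP; split.
    have [_ Cdown] := C_complex; apply: Cdown (above_sub fa) _ uf.
    by rewrite -card_gt0 cu.
  by apply/forall_inP => v /(subsetP uf); apply: above_high.
(* The functional counting the label set [t] is applied to both sides of [eb]: on the cycle it gives
   [z t], on the boundary of [b] it gives [bd w' t]. *)
have <- : fglift (H n t : _ -> ('F_2)^o) (@sing R k V p n z) = z t.
  rewrite /sing fglift_sum; under eq_bigr do rewrite liftU.
  rewrite (bigD1 t) //= big1 ?addr0 => [|s st].
    have [->|/zK[ta tn]] := eqVneq (z t) 0; first by rewrite scale0r.
    by rewrite /H label_count_aff // eqxx -[LHS]/(_ * _) mulr1.
  have [->|/zK[sa sn]] := eqVneq (z s) 0; first by rewrite scale0r.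
  by rewrite /H label_count_aff // (negPf st) scaler0.
rewrite -[sing _ _ _]subr0 eb -[in RHS](freeg_sumE b) /boundary !fglift_sum /bd /w'.
rewrite exchange_big; apply: eq_bigr => g _ /=.
rewrite liftU -mulr_sumr -label_count_coface scaler_sumr fglift_sum mulr_sumr.
by apply: eq_bigr => i _; rewrite -freegZ liftU.
Qed.

End Tight.

Theorem theorem2p7 (R : realType) (V : finType) (C : {set {set V}})
    (C_complex : simplicial_complex C)
    (C_manifold : triangulates_manifold R 3 C)
    (C_tight : exists (k : nat) (dir : 'rV[R]_k) (p : V -> 'rV[R]_k),
      [/\ dir != 0, linear_embedding C p, general_position C p dir &
          tight dir (polyhedron C p)]) :
  exists f : {set V} -> int, discrete_morse C f /\ perfect C f.
Proof.
have [k [dir [p [_ p_emb gp X_tight]]]] := C_tight.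
apply: (tight_perfect (ht := fun u => dotp dir (p u))) => //.
- by move=> s; apply: (manifold_dim C_manifold).
- by move=> t; apply: (manifold_pseudo C_manifold).
- by move=> v _; apply: tight_simplicial.
Qed.
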